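(* Let $R$ be a ring and let $A$, $B$, $C'$ be $n\times n$ matrices over $R$. Suppose that $C'$ differs from the matrix product $C=A\times B$ in at most $k$ entries. There is a randomized algorithm that, given $A$, $B$, $C'$ and $k$, transforms $C'$ into the product $A\times B$ in $O\big((n+k\log k\log\log k)\,n\log n\big)$ time (in particular $\tilde{O}(n^2+kn)$ time) almost surely, i.e., for any constant $\alpha\ge 1$ (the algorithm may depend on $\alpha$), with probability at least $1-n^{-\alpha}$ it outputs $A\times B$ within this time bound.
   Context: Running time is measured in a unit-cost model where each ring operation and elementary operation costs $O(1)$; $\tilde{O}$ suppresses factors polylogarithmic in $n$ and $k$. *)

(* Defs.v *)
From Stdlib Require Reals.
From HB Require Import structures.
From mathcomp Require Import all_boot all_order all_algebra.
Set Implicit Arguments. Unset Strict Implicit. Unset Printing Implicit Defensive.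
Import GRing.Theory.
Local Open Scope ring_scope.

(* A randomized unit-cost RAM over an arbitrary ring.                        *)
(* Two memories: a nat memory (indices/counters, "elementary operations")   *)
(* and a ring-value memory.  Every instruction (ring operation, ring        *)
(* equality test, nat operation, memory move, jump, random coin) costs 1.   *)
(* Ring-value instructions address their cells indirectly through nat       *)
(* registers: V[N[d]].  The program is a fixed instruction list, uniform in *)
(* the ring, n and k.                                                        *)

Inductive instr : Type :=
| NConst of nat & nat          (* N[d] := c                      *)
| NAdd of nat & nat & nat      (* N[d] := N[a] + N[b]            *)
| NSub of nat & nat & nat      (* N[d] := N[a] - N[b] (truncated) *)
| NMul of nat & nat & nat      (* N[d] := N[a] * N[b]            *)
| NDiv of nat & nat & nat      (* N[d] := N[a] %/ N[b]           *)
| NMod of nat & nat & nat      (* N[d] := N[a] %% N[b]           *)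
| NLoad of nat & nat           (* N[d] := N[N[a]]                *)
| NStore of nat & nat          (* N[N[d]] := N[a]                *)
| VZero of nat                 (* V[N[d]] := 0                   *)
| VOne of nat                  (* V[N[d]] := 1                   *)
| VAdd of nat & nat & nat      (* V[N[d]] := V[N[a]] + V[N[b]]   *)
| VOpp of nat & nat            (* V[N[d]] := - V[N[a]]           *)
| VMul of nat & nat & nat      (* V[N[d]] := V[N[a]] * V[N[b]]   *)
| VCopy of nat & nat           (* V[N[d]] := V[N[a]]             *)
| JVEq of nat & nat & nat      (* if V[N[a]] == V[N[b]] goto l   *)
| JNLt of nat & nat & nat      (* if N[a] < N[b] goto l          *)
| JNEq of nat & nat & nat      (* if N[a] == N[b] goto l         *)
| Jmp of nat                   (* goto l                         *)
| Coin of nat                  (* N[d] := next random bit        *)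
| Halt.

Definition program := seq instr.

Record state (R : Type) := State {
  pc : nat;
  nmem : nat -> nat;
  vmem : nat -> R;
  coinpos : nat;
  halted : bool }.

Definition upd {T : Type} (m : nat -> T) (x : nat) (v : T) : nat -> T :=
  fun y => if y == x then v else m y.

Section Semantics.
Variable (R : pzRingType) (P : program) (coins : nat -> bool).

Definition step (s : state R) : state R :=
  if halted s then s else
  let N := nmem s in let V := vmem s in let p := pc s in
  let nxt n' v' := State p.+1 n' v' (coinpos s) false in
  let jmp b l := State (if b then l else p.+1) N V (coinpos s) false in
  match nth Halt P p with
  | NConst d c => nxt (upd N d c) V
  | NAdd d a b => nxt (upd N d (N a + N b)%N) V
  | NSub d a b => nxt (upd N d (N a - N b)%N) V
  | NMul d a b => nxt (upd N d (N a * N b)%N) V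
  | NDiv d a b => nxt (upd N d (N a %/ N b)%N) V
  | NMod d a b => nxt (upd N d (N a %% N b)%N) V
  | NLoad d a => nxt (upd N d (N (N a))) V
  | NStore d a => nxt (upd N (N d) (N a)) V
  | VZero d => nxt N (upd V (N d) 0)
  | VOne d => nxt N (upd V (N d) 1)
  | VAdd d a b => nxt N (upd V (N d) (V (N a) + V (N b)))
  | VOpp d a => nxt N (upd V (N d) (- V (N a)))
  | VMul d a b => nxt N (upd V (N d) (V (N a) * V (N b)))
  | VCopy d a => nxt N (upd V (N d) (V (N a)))
  | JVEq a b l => jmp (V (N a) == V (N b)) l
  | JNLt a b l => jmp (N a < N b)%N l
  | JNEq a b l => jmp (N a == N b) l
  | Jmp l => jmp true l
  | Coin d => State p.+1 (upd N d (nat_of_bool (coins (coinpos s)))) V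
                    (coinpos s).+1 false
  | Halt => State p N V (coinpos s) true
  end.

Definition run (t : nat) (s : state R) : state R := iter t step s.

End Semantics.

(* entry x = i*n + j of a matrix stored row-major; 0 outside *)
Definition mx_at (R : pzRingType) (n : nat) (M : 'M[R]_n) (x : nat) : R :=
  match (insub (x %/ n)%N : option 'I_n), (insub (x %% n)%N : option 'I_n) with
  | Some i, Some j => M i j
  | _, _ => 0
  end.

(* Input layout: nat registers N[0] = n, N[1] = k; value memory holds A in
   cells [0, n^2), B in [n^2, 2n^2), C' in [2n^2, 3n^2) (row-major), 0 else. *)
Definition init_state (R : pzRingType) (n k : nat) (A B C' : 'M[R]_n) : state R :=
  State 0 (upd (upd (fun _ => 0%N) 0 n) 1 k)
    (fun x => if (x < n * n)%N then mx_at A x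
              else if (x < 2 * (n * n))%N then mx_at B (x - n * n)
              else if (x < 3 * (n * n))%N then mx_at C' (x - 2 * (n * n))
              else 0)
    0 true.

Definition init_state' (R : pzRingType) (n k : nat) (A B C' : 'M[R]_n) : state R :=
  let s := init_state k A B C' in State (pc s) (nmem s) (vmem s) 0 false.

Definition succeeds (R : pzRingType) (P : program) (n k T : nat)
    (A B C' : 'M[R]_n) (c : {ffun 'I_T -> bool}) : bool :=
  let coins := fun m : nat =>
    match (insub m : option 'I_T) with Some i => c i | None => false end in
  let s := run P coins T (init_state' k A B C') in
  halted s &&
  [forall i : 'I_n, forall j : 'I_n,
     vmem s (2 * (n * n) + (i * n + j))%N == (A *m B) i j].

(* Probability (over T uniform random bits; at most T bits are read in T
   steps) that the machine succeeds within T steps. *)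
Definition success_prob (R : pzRingType) (P : program) (n k T : nat)
    (A B C' : 'M[R]_n) : Reals.Rdefinitions.R :=
  Reals.Rdefinitions.Rdiv
    (Reals.Raxioms.INR #|[set c : {ffun 'I_T -> bool} | succeeds P k A B C' c]|)
    (Reals.Rpow_def.pow (Reals.Raxioms.INR 2) T).

(* log with the usual O-notation convention log m >= 1: floor(log2 m) + 1 *)
Definition lg (m : nat) : nat := (trunc_log 2 m).+1.

Definition time_bound (c n k : nat) : nat :=
  (c * ((n + k * lg k * lg (lg k)) * n * lg n))%N.

Definition ndiff (R : pzRingType) (n : nat) (A B C' : 'M[R]_n) : nat :=
  #|[set ij : 'I_n * 'I_n | C' ij.1 ij.2 != (A *m B) ij.1 ij.2]|.

Definition whp_bound (n : nat) (alpha : Reals.Rdefinitions.R) : Reals.Rdefinitions.R :=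
  Reals.Rdefinitions.Rminus Reals.Rdefinitions.R1
    (Reals.Rpower.Rpower (Reals.Raxioms.INR n) (Reals.Rdefinitions.Ropp alpha)).

(* Main.v *)
Require Import Defs.
From Stdlib Require Import Reals Lra.
From mathcomp Require Import all_boot all_order all_algebra.
From mathcomp Require Import zify.

(** Let E = AB - C'. The machine draws L = O(log n) random 0/1 vectors r and
    stores, for each of them, all prefix sums of the columns of B weighted
    by r. Then the sum of E i j * r j over an interval of columns j can be
    computed in O(n) operations, as the i-th row of A times a difference of two
    prefix sums, minus the corresponding sum of entries of C'. If E i has a
    nonzero entry in the interval, each r makes this sum nonzero with
    probability at least 1/2, so by a union bound over the n^3 triples
    (row, interval) all nonzero intervals are detected simultaneously with
    probability at least 1 - n^3 / 2^L. On that event, in each row a binary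
    search on the right end of the interval finds the errors from left to
    right, and each of them is corrected by recomputing one entry. This takes
    n + O(k log n) interval tests of cost O(n log n), and
    k log n = O(n + k log k). *)

Set Implicit Arguments. Unset Strict Implicit. Unset Printing Implicit Defensive.
Import GRing.Theory.
Local Open Scope ring_scope.

(** * A structured language compiled to the machine *)

Inductive cond := CVEq of nat & nat | CNLt of nat & nat.

Inductive cmd :=
| Block of seq instr
| Seq of cmd & cmd
| If of cond & cmd & cmd
| While of cond & cmd.

Notation "c1 ;; c2" := (Seq c1 c2) (at level 80, right associativity).

Definition jump_if (b : cond) (l : nat) : instr :=
  match b with CVEq x y => JVEq x y l | CNLt x y => JNLt x y l end.

Fixpoint csize (c : cmd) : nat :=
  match c with
  | Block s => size s
  | c1 ;; c2 => csize c1 + csize c2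
  | If _ c1 c2 => (csize c2 + csize c1).+2
  | While _ c1 => (csize c1).+3
  end.

(** Jump targets are absolute, so the code depends on its position [off]. In a conditional the else
    branch comes first, followed by a jump over the then branch. *)
Fixpoint compile (off : nat) (c : cmd) : program :=
  match c with
  | Block s => s
  | c1 ;; c2 => compile off c1 ++ compile (off + csize c1) c2
  | If b c1 c2 =>
      jump_if b (off.+2 + csize c2) ::
      compile off.+1 c2 ++ Jmp (off.+2 + csize c2 + csize c1)
        :: compile (off.+2 + csize c2) c1
  | While b c1 =>
      [:: jump_if b off.+2, Jmp (off + (csize c1).+3)
        & rcons (compile off.+2 c1) (Jmp off)]
  end.

Lemma size_compile off c : size (compile off c) = csize c.
Proof.
elim: c off => //= [c1 IH1 c2 IH2|b c1 IH1 c2 IH2|b c1 IH1] off.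
- by rewrite size_cat IH1 IH2.
- by rewrite size_cat /= IH1 IH2 addnS.
- by rewrite size_rcons IH1.
Qed.

Definition code_at (P : program) (off : nat) (q : program) :=
  forall x, (x < size q)%N -> nth Halt P (off + x)%N = nth Halt q x.

Lemma code_at_cons P off i q :
  code_at P off (i :: q) -> nth Halt P off = i /\ code_at P off.+1 q.
Proof.
move=> h; split; first by have := h 0%N isT; rewrite addn0.
by move=> x hx; rewrite addSnnS h.
Qed.

Lemma code_at_cat P off q1 q2 :
  code_at P off (q1 ++ q2) ->
  code_at P off q1 /\ code_at P (off + size q1) q2.
Proof.
move=> h; split=> x hx.
  by rewrite h ?size_cat ?ltn_addr // nth_cat hx.
rewrite -addnA h ?size_cat ?ltn_add2l // nth_cat ltnNge leq_addr /=.
by rewrite addKn.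
Qed.

(* Updates of the two memories get different names, so that [/=] evaluates
   reads at literal registers but leaves symbolic ring addresses alone. *)
Definition vupd (T : Type) : (nat -> T) -> nat -> T -> nat -> T := @upd T.
Arguments upd {T} m x v y /.

(** * A program logic that counts steps *)

Section Logic.
Variables (R : pzRingType) (coins : nat -> bool).
Implicit Types (N : nat -> nat) (V : nat -> R) (cp t off : nat).
Implicit Types (Q : (nat -> nat) -> (nat -> R) -> nat -> Prop).

Definition holds (b : cond) N V : bool :=
  match b with
  | CVEq x y => V (N x) == V (N y)
  | CNLt x y => (N x < N y)%N
  end.

(** Weakest precondition of straight-line code. Jumps and [Halt] get [False], so a verified block
    always runs through to its end. *)
Fixpoint wpb (s : seq instr) N V cp Q : Prop :=
  match s with
  | [::] => Q N V cp
  | i :: s' =>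
    match i with
    | NConst d c => wpb s' (upd N d c) V cp Q
    | NAdd d a b => wpb s' (upd N d (N a + N b)%N) V cp Q
    | NSub d a b => wpb s' (upd N d (N a - N b)%N) V cp Q
    | NMul d a b => wpb s' (upd N d (N a * N b)%N) V cp Q
    | NDiv d a b => wpb s' (upd N d (N a %/ N b)%N) V cp Q
    | NMod d a b => wpb s' (upd N d (N a %% N b)%N) V cp Q
    | NLoad d a => wpb s' (upd N d (N (N a))) V cp Q
    | NStore d a => wpb s' (upd N (N d) (N a)) V cp Q
    | VZero d => wpb s' N (vupd V (N d) 0) cp Q
    | VOne d => wpb s' N (vupd V (N d) 1) cp Q
    | VAdd d a b => wpb s' N (vupd V (N d) (V (N a) + V (N b))) cp Q
    | VOpp d a => wpb s' N (vupd V (N d) (- V (N a))) cp Q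
    | VMul d a b => wpb s' N (vupd V (N d) (V (N a) * V (N b))) cp Q
    | VCopy d a => wpb s' N (vupd V (N d) (V (N a))) cp Q
    | Coin d => wpb s' (upd N d (nat_of_bool (coins cp))) V cp.+1 Q
    | _ => False
    end
  end.

(** Total correctness with a time bound. A concrete starting memory replaces the precondition, so
    [t] and [Q] may depend on it; quantifying over [P] and [off] makes triples compose. *)
Definition triple (c : cmd) N V cp t Q :=
  forall P off, code_at P off (compile off c) ->
  exists t' N' V' cp', [/\ (t' <= t)%N,
    run P coins t' (State off N V cp false) =
      State (off + csize c) N' V' cp' false & Q N' V' cp'].

Lemma runD P t1 t2 (s : state R) :
  run P coins (t1 + t2) s = run P coins t2 (run P coins t1 s).
Proof. by rewrite /run addnC iterD. Qed.

Lemma triple_conseq c N V cp t t' Q Q' :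
  triple c N V cp t Q -> (t <= t')%N ->
  (forall N' V' cp', Q N' V' cp' -> Q' N' V' cp') -> triple c N V cp t' Q'.
Proof.
move=> h tt' hQ P off hP; have [u [N' [V' [cp' [h1 h2 h3]]]]] := h P off hP.
by exists u, N', V', cp'; split => //; [exact: leq_trans tt' | exact: hQ].
Qed.

Lemma triple_le c N V cp t t' Q :
  (t <= t')%N -> triple c N V cp t Q -> triple c N V cp t' Q.
Proof. by move=> tt' h; apply: triple_conseq h tt' _. Qed.

Lemma triple_block s N V cp Q :
  wpb s N V cp Q -> triple (Block s) N V cp (size s) Q.
Proof.
move=> h P off hP; exists (size s).
elim: s N V cp off h hP => [|i s IH] N V cp off h.
  by exists N, V, cp; rewrite addn0.
move=> /code_at_cons[hi hs].
suff [N1 [V1 [cp1 [h1 h2]]]] : exists N1 V1 cp1, wpb s N1 V1 cp1 Q /\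
    step P coins (State off N V cp false) = State off.+1 N1 V1 cp1 false.
  have [N' [V' [cp' [_ h3 h4]]]] := IH _ _ _ _ h1 hs.
  exists N', V', cp'; split=> //.
  by rewrite -[size (i :: s)]/(1 + size s)%N runD [run _ _ 1 _]h2 h3 addSnnS.
rewrite /step /= hi; move: h.
by case: i {hi} => //= *; do 3!eexists; split; eauto.
Qed.

Lemma triple_seq c1 c2 N V cp t1 t2 Q :
  triple c1 N V cp t1 (fun N1 V1 cp1 => triple c2 N1 V1 cp1 t2 Q) ->
  triple (c1 ;; c2) N V cp (t1 + t2) Q.
Proof.
move=> h P off /= /code_at_cat[h1 h2].
have [u1 [N1 [V1 [cp1 [hu1 r1]]]]] := h P off h1.
rewrite size_compile in h2; move=> /(_ P _ h2) [u2 [N2 [V2 [cp2 [hu2 r2 hQ]]]]].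
exists (u1 + u2)%N, N2, V2, cp2; split=> //; first exact: leq_add.
by rewrite runD r1 r2 addnA.
Qed.

Lemma triple_block_seq s c N V cp t Q :
  wpb s N V cp (fun N1 V1 cp1 => triple c N1 V1 cp1 t Q) ->
  triple (Block s ;; c) N V cp (size s + t) Q.
Proof. by move=> h; apply/triple_seq/triple_block. Qed.

Lemma triple_seq_conseq c1 c2 N V cp t1 t2 Q1 Q :
  triple c1 N V cp t1 Q1 ->
  (forall N1 V1 cp1, Q1 N1 V1 cp1 -> triple c2 N1 V1 cp1 t2 Q) ->
  triple (c1 ;; c2) N V cp (t1 + t2) Q.
Proof.
by move=> h1 h2; apply: triple_seq; apply: triple_conseq h1 (leqnn _) h2.
Qed.

Lemma step_jump P b l off N V cp :
  nth Halt P off = jump_if b l ->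
  run P coins 1 (State off N V cp false) =
  State (if holds b N V then l else off.+1) N V cp false.
Proof. by move=> h; rewrite /run /= /step /= h; case: b {h}. Qed.

Lemma step_jmp P l off N V cp :
  nth Halt P off = Jmp l ->
  run P coins 1 (State off N V cp false) = State l N V cp false.
Proof. by move=> h; rewrite /run /= /step /= h. Qed.

Lemma triple_if b c1 c2 N V cp t Q :
  (holds b N V -> triple c1 N V cp t Q) ->
  (~~ holds b N V -> triple c2 N V cp t Q) ->
  triple (If b c1 c2) N V cp (t + 2) Q.
Proof.
move=> ht hf P off /= /code_at_cons[hj /code_at_cat[h2 /code_at_cons[hk h1]]].
rewrite size_compile in hk h1; rewrite addSn in h1.
have := step_jump N V cp hj; case: ifP => hb rj.
  have [u [N' [V' [cp' [hu r hQ]]]]] := ht hb P _ h1.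
  exists (1 + u)%N, N', V', cp'; split => //; first by lia.
  by rewrite runD rj r; congr State; lia.
have [u [N' [V' [cp' [hu r hQ]]]]] := hf (negbT hb) P _ h2.
exists (1 + (u + 1))%N, N', V', cp'; split => //; first by lia.
by rewrite runD rj runD r (step_jmp _ _ _ hk); congr State; lia.
Qed.

(** The two steps are the failing conditional jump and the jump out of the loop. *)
Lemma triple_while_false b c N V cp Q :
  ~~ holds b N V -> Q N V cp -> triple (While b c) N V cp 2 Q.
Proof.
move=> /negbTE hb hQ P off /= /code_at_cons[hj /code_at_cons[hk _]].
exists 2%N, N, V, cp; split=> //.
by rewrite -[2%N]/(1 + 1)%N runD (step_jump _ _ _ hj) hb (step_jmp _ _ _ hk).
Qed.

Lemma triple_while_true b c N V cp t1 t2 Q :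
  holds b N V ->
  triple c N V cp t1 (fun N1 V1 cp1 => triple (While b c) N1 V1 cp1 t2 Q) ->
  triple (While b c) N V cp (t1 + t2 + 2) Q.
Proof.
move=> hb h P off hP; have := hP => /= /code_at_cons[hj /code_at_cons[_]].
rewrite -cats1 => /code_at_cat[h1 /code_at_cons[hk _]].
rewrite size_compile in hk.
have [u1 [N1 [V1 [cp1 [hu1 r1]]]]] := h P _ h1.
move=> /(_ P _ hP) [u2 [N2 [V2 [cp2 [hu2 r2 hQ]]]]].
exists (1 + (u1 + (1 + u2)))%N, N2, V2, cp2; split=> //; first by lia.
by rewrite runD (step_jump _ _ _ hj) hb runD r1 runD (step_jmp _ _ _ hk) r2.
Qed.

(** Each increment overwrites register 2, which is why every list of modified registers below
    contains 2. *)
Definition Loop (x y : nat) (c : cmd) : cmd :=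
  While (CNLt x y) (c ;; Block [:: NConst 2 1; NAdd x x 2]).

(** The cost may vary with the index, since a row with more errors takes longer. The increment of
    [x] is absorbed in the postcondition of the body; the 4 extra steps per round are the test, the
    two increment instructions and the jump back. *)
Lemma triple_loop x y c (I : nat -> _ -> _ -> _ -> Prop) (cost : nat -> nat)
    a m N V cp :
  (a <= m)%N -> I a N V cp ->
  (forall i N V cp, I i N V cp -> N x = i /\ N y = m) ->
  (forall i N V cp, (a <= i < m)%N -> I i N V cp ->
    triple c N V cp (cost i)
      (fun N' V' cp' => wpb [:: NConst 2 1; NAdd x x 2] N' V' cp' (I i.+1))) ->
  triple (Loop x y c) N V cp (\sum_(a <= i < m) (cost i + 4) + 2)%N (I m).
Proof.
move=> am hI hxy hc; have [k hk] : exists k, (m = a + k)%N.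
  by exists (m - a)%N; lia.
elim: k a N V cp am hI hk hc => [|k IH] a N V cp am hI hk hc.
  have [hx hy] := hxy _ _ _ _ hI.
  rewrite addn0 in hk; rewrite hk big_geq // add0n.
  by apply: triple_while_false; rewrite //= hx hy hk ltnn.
have [hx hy] := hxy _ _ _ _ hI.
have lt_am : (a < m)%N by lia.
rewrite big_ltn //.
apply: (@triple_le _ _ _ _
  (cost a + 2 + (\sum_(a.+1 <= i < m) (cost i + 4) + 2) + 2)); first by lia.
apply: triple_while_true; first by rewrite /= hx hy.
apply: triple_seq; apply: triple_conseq (leqnn _) _.
  by apply: hc hI; rewrite leqnn.
move=> N1 V1 cp1 h1; apply: triple_conseq (leqnn _) _.
  exact: triple_block h1.
move=> N2 V2 cp2 h2; apply: IH => //; first by lia.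
by move=> i ? ? ? /andP[h3 h4]; apply: hc; rewrite h4 (ltnW h3).
Qed.

Lemma triple_loop_const x y c (I : nat -> _ -> _ -> _ -> Prop) K a m N V cp :
  (a <= m)%N -> I a N V cp ->
  (forall i N V cp, I i N V cp -> N x = i /\ N y = m) ->
  (forall i N V cp, (a <= i < m)%N -> I i N V cp ->
    triple c N V cp K
      (fun N' V' cp' => wpb [:: NConst 2 1; NAdd x x 2] N' V' cp' (I i.+1))) ->
  triple (Loop x y c) N V cp ((m - a) * (K + 4) + 2)%N (I m).
Proof.
move=> h1 h2 h3 h4; have := triple_loop h1 h2 h3 h4.
by rewrite sum_nat_const_nat.
Qed.

End Logic.

(** * Frames: which cells may have changed *)

Definition frame (T : Type) (ms : seq nat) (m m' : nat -> T) :=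
  forall x, x \notin ms -> m' x = m x.

Lemma frame_upd T ms (m m' : nat -> T) d v :
  frame ms m m' -> d \in ms -> frame ms m (upd m' d v).
Proof.
move=> h hd x hx; rewrite /upd; case: eqP => [e|_]; last exact: h.
by rewrite e hd in hx.
Qed.

Lemma frame_trans T ms ms' (m m' m'' : nat -> T) :
  frame ms m m' -> frame ms' m' m'' -> all (mem ms) ms' -> frame ms m m''.
Proof.
move=> h h' /allP hs x hx; rewrite h' ?h //.
by apply: contra hx => /hs.
Qed.

Lemma frame_vupd T ms (m m' : nat -> T) d v :
  frame ms m m' -> d \in ms -> frame ms m (vupd m' d v).
Proof. exact: frame_upd. Qed.

Lemma vupd_eq T (m : nat -> T) x v : vupd m x v x = v.
Proof. by rewrite /vupd /upd eqxx. Qed.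

Lemma vupd_ne T (m : nat -> T) x v y : y != x -> vupd m x v y = m y.
Proof. by rewrite /vupd /upd => /negbTE->. Qed.

(** * The program *)

(* Registers: 0 = n, 2 = temporary constant, 3 = L, 4 = power of two,
   5, 6, 7, 8 = indices l, j, t, i, 9 and 10 = ends p and b of the tested
   interval of columns, 11 and 12 = bounds of the binary search, 13 = verdict of
   the test, 14 = n + 1, 15 = base address of B, 16 = base address of C',
   17 = address of a ring cell that stays 0, 18 = address of the accumulator,
   19 = address of a temporary ring cell, 20 = base address of the random
   vectors, 21 = base address of the prefix sums, 22, 23, 24 = temporaries,
   25 = D, 26 = never written, hence 0. *)
Definition init (D : nat) : cmd :=
  Block [:: NConst 2 1; NAdd 14 0 2; NConst 4 1; NConst 25 D] ;;
  While (CNLt 4 14) (Block [:: NAdd 4 4 4; NAdd 3 3 25]) ;;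
  Block [:: NMul 15 0 0; NAdd 16 15 15; NAdd 17 16 15; NConst 2 1;
            NAdd 18 17 2; NAdd 19 18 2; NAdd 20 19 2;
            NMul 22 3 0; NAdd 21 20 22].

(** Extends the prefix sums of vector [l] by column [j]: the cell for [j + 1] lies [n] places after
    the cell for [j]. *)
Definition prefix_loop : cmd :=
  Loop 7 0 (Block [:: NMul 23 7 0; NAdd 23 23 6; NAdd 23 23 15;
    VMul 19 23 22;
    NMul 23 5 14; NAdd 23 23 6; NMul 23 23 0; NAdd 23 23 7; NAdd 23 23 21;
    NAdd 24 23 0; VAdd 24 23 19]).

(** A coin is a natural number; it becomes a ring element by writing 0 and overwriting it with 1 if
    the coin exceeds register 26, which is 0. *)
Definition tables : cmd :=
  Block [:: NConst 5 0] ;;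
  Loop 5 3 (
    Block [:: NConst 6 0] ;;
    Loop 6 0 (
      Block [:: Coin 24; NMul 22 5 0; NAdd 22 22 6; NAdd 22 22 20; VZero 22] ;;
      If (CNLt 26 24) (Block [:: VOne 22]) (Block [::]) ;;
      Block [:: NConst 7 0] ;;
      prefix_loop)).

Definition dot_loop : cmd :=
  Loop 7 0 (Block [:: NMul 22 5 14;
    NAdd 23 22 10; NMul 23 23 0; NAdd 23 23 7; NAdd 23 23 21;
    NAdd 22 22 9; NMul 22 22 0; NAdd 22 22 7; NAdd 22 22 21;
    VOpp 19 22; VAdd 19 23 19;
    NMul 22 8 0; NAdd 22 22 7; VMul 19 22 19; VAdd 18 18 19]).

Definition sub_loop : cmd :=
  Loop 6 10 (Block [:: NMul 22 8 0; NAdd 22 22 6; NAdd 22 22 16;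
    NMul 23 5 0; NAdd 23 23 6; NAdd 23 23 20;
    VMul 19 22 23; VOpp 19 19; VAdd 18 18 19]).

Definition test : cmd :=
  Block [:: NConst 13 0; NConst 5 0] ;;
  Loop 5 3 (
    Block [:: NConst 7 0; VZero 18] ;;
    dot_loop ;;
    Block [:: NAdd 6 9 26] ;;
    sub_loop ;;
    If (CVEq 18 17) (Block [::]) (Block [:: NConst 13 1])).

Definition fix_entry : cmd :=
  Block [:: NConst 7 0; VZero 18] ;;
  Loop 7 0 (Block [:: NMul 22 8 0; NAdd 22 22 7;
    NMul 23 7 0; NAdd 23 23 11; NAdd 23 23 15;
    VMul 19 22 23; VAdd 18 18 19]) ;;
  Block [:: NMul 22 8 0; NAdd 22 22 11; NAdd 22 22 16; VCopy 22 18].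

(** The tested interval always starts at [p] and ends at the midpoint of the two bounds. Register 22
    holds the lower bound plus one, so the loop stops once the bounds are adjacent. *)
Definition search : cmd :=
  Block [:: NAdd 11 9 26; NAdd 12 0 26; NConst 2 1; NAdd 22 11 2] ;;
  While (CNLt 22 12) (
    Block [:: NAdd 10 11 12; NConst 2 2; NDiv 10 10 2] ;;
    test ;;
    If (CNLt 26 13) (Block [:: NAdd 12 10 26]) (Block [:: NAdd 11 10 26]) ;;
    Block [:: NConst 2 1; NAdd 22 11 2]).

(** After a correction [p] moves just past the corrected column, so only columns with their initial
    content are tested. *)
Definition row : cmd :=
  Block [:: NConst 9 0; NAdd 10 0 26] ;;
  test ;;
  While (CNLt 26 13) (
    search ;;
    fix_entry ;;
    Block [:: NAdd 9 12 26; NAdd 10 0 26] ;;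
    test).

Definition correct_product (D : nat) : cmd :=
  init D ;; tables ;; Block [:: NConst 8 0] ;; Loop 8 0 row.

Lemma row_major_lt (m n i j : nat) : (i < m)%N -> (j < n)%N -> (i * n + j < m * n)%N.
Proof. by move=> hi hj; have := leq_mul hi (leqnn n); lia. Qed.

Lemma row_major_inj (n i j i' j' : nat) : (j < n)%N -> (j' < n)%N ->
  (i * n + j = i' * n + j')%N -> i = i' /\ j = j'.
Proof.
move=> hj hj' e; have n0 : (0 < n)%N by lia.
have hd : i = i'.
  by have := congr1 (divn^~ n) e; rewrite /= !divnMDl // !divn_small // !addn0.
by split=> //; subst i'; lia.
Qed.

(** * Specification of the program *)

Section Spec.
Variables (R : pzRingType) (coins : nat -> bool) (n L : nat) (V0 : nat -> R).
Implicit Types (N : nat -> nat) (V : nat -> R) (cp t : nat).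

Local Notation triple := (@triple R coins).

(* Addresses of A i t, B t j, C' i j, three scratch cells, the j-th entry of
   the l-th random vector, and the t-th entry of its j-th prefix sum. *)
Definition aA i t : nat := (i * n + t)%N.
Definition aB t j : nat := (t * n + j + n * n)%N.
Definition aC i j : nat := (i * n + j + (n * n + n * n))%N.
Definition aS x : nat := (n * n + n * n + n * n + x)%N.
Definition aR l j : nat := (l * n + j + aS 3)%N.
Definition aP l j t : nat := ((l * n.+1 + j) * n + t + (aS 3 + L * n))%N.

(** The registers that keep their values once [init] has run. As one equation between lists it
    splits by injectivity into one equation per register. *)
Definition cst N := map N [:: 0; 3; 14; 15; 16; 17; 18; 19; 20; 21; 26] =
  [:: n; L; n.+1; n * n; n * n + n * n; aS 0; aS 1; aS 2; aS 3; aS 3 + L * n;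
      0]%N.

Definition rv l j : R := (coins (l * n + j))%:R.
Definition psum l j t : R := \sum_(0 <= j' < j) V0 (aB t j') * rv l j'.
(** The matrix [E] of the initial memory [V0]. It does not follow later corrections, so
    specifications also say which cells of [C'] still hold their initial values. *)
Definition err i j : R :=
  \sum_(0 <= t < n) V0 (aA i t) * V0 (aB t j) - V0 (aC i j).
Definition esum i l p b : R := \sum_(p <= j < b) err i j * rv l j.

(** What the tests rely on in every row: inputs [A] and [B], the zero cell and the tables. [C'] is
    left out because its cells get corrected. *)
Definition ready V := [/\ forall x, (x < n * n + n * n)%N -> V x = V0 x,
  V (aS 0) = 0,
  forall l j, (l < L)%N -> (j < n)%N -> V (aR l j) = rv l j &
  forall l j t, (l < L)%N -> (j <= n)%N -> (t < n)%N -> V (aP l j t) = psum l j t].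

(** * Separation of the memory regions *)

Lemma aA_lt i t : (i < n)%N -> (t < n)%N -> (aA i t < n * n)%N.
Proof. by move=> *; apply: row_major_lt. Qed.

Lemma aB_lt t j : (t < n)%N -> (j < n)%N -> (aB t j < n * n + n * n)%N.
Proof. by move=> *; rewrite /aB ltn_add2r row_major_lt. Qed.

Lemma aC_lt i j : (i < n)%N -> (j < n)%N -> (aC i j < aS 0)%N.
Proof. by move=> hi hj; have := row_major_lt hi hj; rewrite /aC /aS; lia. Qed.

Lemma aC_ge i j : (n * n + n * n <= aC i j)%N.
Proof. by rewrite /aC; lia. Qed.

Lemma aR_ge l j : (aS 3 <= aR l j)%N.
Proof. by rewrite /aR; lia. Qed.

Lemma aP_ge l j t : (aS 3 + L * n <= aP l j t)%N.
Proof. by rewrite /aP; lia. Qed.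

Lemma aR_lt l j : (l < L)%N -> (j < n)%N -> (aR l j < aS 3 + L * n)%N.
Proof. by move=> hl hj; have := row_major_lt hl hj; rewrite /aR; lia. Qed.

Definition scratch := [:: aS 1; aS 2].

Lemma scratchE x : (x < aS 1)%N || (aS 3 <= x)%N -> x \notin scratch.
Proof. by rewrite /scratch !inE /aS; lia. Qed.

Lemma ready_frame_all ms V V' : ready V -> frame ms V V' ->
  all (fun x => (n * n + n * n <= x < aS 3)%N && (x != aS 0)) ms -> ready V'.
Proof.
move=> [h1 h2 h3 h4] hf /allP hms.
have hout x : (x < n * n + n * n)%N || (aS 3 <= x)%N || (x == aS 0) -> V' x = V x.
  by move=> hx; apply: hf; apply/negP => /hms; lia.
split=> [x hx||l j hl hj|l j t hl hj ht]; rewrite hout ?eqxx ?orbT //.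
- exact: h1.
- by rewrite hx.
- exact: h3.
- by rewrite aR_ge orbT.
- exact: h4.
- by have := aP_ge l j t; lia.
Qed.

Lemma ready_frame V V' : ready V -> frame scratch V V' -> ready V'.
Proof. by move=> h hf; apply: ready_frame_all h hf _; rewrite /= /aS; lia. Qed.

Lemma cst_frame ms N N' : cst N -> frame ms N N' ->
  ~~ has (mem ms) [:: 0; 3; 14; 15; 16; 17; 18; 19; 20; 21; 26] -> cst N'.
Proof.
rewrite /cst => <- hf hm; apply/eq_in_map => r hr; apply: hf.
by apply: contraNN hm => hms; apply/hasP; exists r.
Qed.

(** The difference of two prefix sums leaves the columns from [p] to [b]; exchanging the sums over
    [t] and [j] turns the row of [A] times this difference into the weighted sum of entries of the
    product. Commutativity is avoided by keeping the random factor on the right. *)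
Lemma dot_sums i l p b : (p <= b)%N ->
  \sum_(0 <= t < n) V0 (aA i t) * (psum l b t - psum l p t) -
    \sum_(p <= j < b) V0 (aC i j) * rv l j = esum i l p b.
Proof.
move=> pb; rewrite /esum /err.
under [RHS]eq_bigr do rewrite mulrBl big_distrl.
rewrite sumrB exchange_big /=; congr (_ - _).
apply: eq_bigr => t _; rewrite /psum (@big_cat_nat _ _ _ p) //= addrAC subrr add0r.
by rewrite big_distrr; apply: eq_bigr => j _ /=; rewrite mulrA.
Qed.

Lemma scratch1 : aS 1 \in scratch. Proof. by rewrite inE eqxx. Qed.
Lemma scratch2 : aS 2 \in scratch. Proof. by rewrite !inE eqxx orbT. Qed.
Lemma aS12 : aS 1 != aS 2. Proof. by rewrite /aS; lia. Qed.
Lemma aA_notin i t : (i < n)%N -> (t < n)%N -> aA i t \notin scratch.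
Proof. by move=> hi ht; rewrite scratchE // /aS; have := aA_lt hi ht; lia. Qed.
Lemma aC_notin i t : (i < n)%N -> (t < n)%N -> aC i t \notin scratch.
Proof.
by move=> hi ht; rewrite scratchE // /aS; have := aC_lt hi ht; rewrite /aS; lia.
Qed.
Lemma aP_notin l j t : aP l j t \notin scratch.
Proof. by rewrite scratchE //; have := aP_ge l j t; lia. Qed.
Lemma notin_ne2 x : x \notin scratch -> x != aS 2.
Proof. by rewrite !inE negb_or => /andP[]. Qed.

(** * Correctness and cost of the interval test *)

Lemma dot_loop_spec N V cp i l p b : cst N -> ready V ->
  N 5 = l -> N 8 = i -> N 9 = p -> N 10 = b -> (l < L)%N -> (i < n)%N ->
  (p <= n)%N -> (b <= n)%N -> N 7 = 0%N -> V (aS 1) = 0 ->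
  triple dot_loop N V cp (n * 19 + 2) (fun N' V' _ =>
    [/\ frame [:: 2; 7; 22; 23]%N N N', frame scratch V V' &
    V' (aS 1) = \sum_(0 <= t < n) V0 (aA i t) * (psum l b t - psum l p t)]).
Proof.
move=> hc hV h5 h8 h9 h10 hl hi hp hb h7 hacc.
set I := fun t N' V' (cp' : nat) => [/\ frame [:: 2; 7; 22; 23]%N N N',
  frame scratch V V', N' 7 = t & V' (aS 1) =
  \sum_(0 <= t' < t) V0 (aA i t') * (psum l b t' - psum l p t')].
apply: (@triple_conseq _ _ _ _ _ _ ((n - 0) * (15 + 4) + 2) _ (I n)) => //.
- apply: triple_loop_const => //.
  + by split=> //; rewrite big_geq.
  + move=> t N' V' cp' [f1 f2 -> _]; split=> //.
    by have [] := cst_frame hc f1 isT.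
  move=> t N' V' cp' /andP[_ ht] [f1 f2 f7 facc].
  have [c0 c3 c14 c15 c16 c17 c18 c19 c20 c21 c26] := cst_frame hc f1 isT.
  have [r1 r2 r3 r4] := ready_frame hV f2.
  apply: triple_block => /=.
  rewrite c0 c14 c18 c19 c21 (f1 5%N isT) (f1 8%N isT) (f1 9%N isT) (f1 10%N isT).
  rewrite f7 h5 h8 h9 h10 -/(aP l b t) -/(aP l p t) -/(aA i t).
  split=> /=; rewrite ?addn1 //.
  + by do 13?[apply: frame_upd => //].
  + by do 4![apply: frame_vupd; rewrite ?scratch1 ?scratch2 //].
  rewrite !vupd_eq !(vupd_ne _ _ aS12) facc.
  rewrite !(vupd_ne _ _ (notin_ne2 (aA_notin hi ht))).
  rewrite !(vupd_ne _ _ (notin_ne2 (aP_notin _ _ _))) !r4 //.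
  by rewrite big_nat_recr //= r1 //; have := aA_lt hi ht; lia.
- by lia.
- by move=> N' V' cp' [].
Qed.

Lemma sub_loop_spec N V cp i l p b : cst N -> ready V ->
  N 5 = l -> N 8 = i -> N 6 = p -> N 10 = b -> (l < L)%N -> (i < n)%N ->
  (p <= b)%N -> (b <= n)%N ->
  (forall j, (p <= j < n)%N -> V (aC i j) = V0 (aC i j)) ->
  triple sub_loop N V cp (n * 13 + 2) (fun N' V' _ =>
    [/\ frame [:: 2; 6; 22; 23]%N N N', frame scratch V V' &
    V' (aS 1) = V (aS 1) - \sum_(p <= j < b) V0 (aC i j) * rv l j]).
Proof.
move=> hc hV h5 h8 h6 h10 hl hi pb bn hC.
set I := fun t N' V' (cp' : nat) => [/\ frame [:: 2; 6; 22; 23]%N N N',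
  frame scratch V V', N' 6 = t & V' (aS 1) =
  V (aS 1) - \sum_(p <= j < t) V0 (aC i j) * rv l j].
apply: (@triple_conseq _ _ _ _ _ _ ((b - p) * (9 + 4) + 2) _ (I b)) => //.
- apply: triple_loop_const => //.
  + by split=> //; rewrite big_geq // subr0.
  + by move=> t N' V' cp' [f1 f2 -> _]; split=> //; rewrite f1.
  move=> j N' V' cp' /andP[pj jb] [f1 f2 f6 facc].
  have [c0 c3 c14 c15 c16 c17 c18 c19 c20 c21 c26] := cst_frame hc f1 isT.
  have [r1 r2 r3 r4] := ready_frame hV f2.
  have jn := leq_trans jb bn.
  apply: triple_block => /=.
  rewrite c0 c16 c18 c19 c20 (f1 5%N isT) (f1 8%N isT).
  rewrite f6 h5 h8 -/(aC i j) -/(aR l j).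
  split=> /=; rewrite ?addn1 //.
  + by do 13?[apply: frame_upd => //].
  + by do 3![apply: frame_vupd; rewrite ?scratch1 ?scratch2 //].
  rewrite !vupd_eq !(vupd_ne _ _ aS12) facc.
  rewrite (f2 _ (aC_notin hi jn)) hC ?pj // r3 //.
  by rewrite big_nat_recr //= opprD addrA.
- by nia.
- by move=> N' V' cp' [].
Qed.

Definition test_mods : seq nat := [:: 2; 5; 6; 7; 13; 22; 23]%N.
Definition test_cost := (L * (32 * n + 20) + 10)%N.

(** Invariant: register 13 records whether one of the vectors tried so far gives a nonzero sum. Only
    columns from [p] on must be unmodified, so the test also applies to partly corrected rows. *)
Lemma test_spec N V cp i p b : cst N -> ready V ->
  N 8 = i -> N 9 = p -> N 10 = b -> (i < n)%N -> (p <= b)%N -> (b <= n)%N ->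
  (forall j, (p <= j < n)%N -> V (aC i j) = V0 (aC i j)) ->
  triple test N V cp test_cost (fun N' V' cp' =>
    [/\ frame test_mods N N', frame scratch V V' &
      N' 13 = has (fun l => esum i l p b != 0) (iota 0 L)]).
Proof.
move=> hc hV h8 h9 h10 hi pb bn hC.
set I := fun l N' V' (cp' : nat) => [/\ frame test_mods N N', frame scratch V V',
  N' 5 = l & N' 13 = has (fun l => esum i l p b != 0) (iota 0 l) :> nat].
apply: (@triple_le _ _ _ _ _ _ (2 + ((L - 0) *
  (2 + (n * 19 + 2 + (1 + (n * 13 + 2 + (1 + 2)))) + 4) + 2))).
  by rewrite /test_cost; nia.
apply: triple_block_seq => /=.
apply: triple_conseq (leqnn _) (_ : forall N' V' cp', I L N' V' cp' -> _);
  last by move=> N' V' cp' [].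
apply: triple_loop_const => //.
- by split=> //=; do 2?[apply: frame_upd => //].
- move=> t N' V' cp' [f1 f2 -> _]; split=> //.
  by have [] := cst_frame hc f1 isT.
move=> l N1 V1 cp1 /andP[_ hl] [f1 f2 f5 f13].
have c1 := cst_frame hc f1 isT.
have [c0 c3 c14 c15 c16 c17 c18 c19 c20 c21 c26] := c1.
have hV1 := ready_frame hV f2.
apply: triple_block_seq => /=; rewrite c18.
apply: triple_seq_conseq.
  apply: (@dot_loop_spec _ _ _ i l p b) => //=.
  - by apply: ready_frame hV1 _; apply: frame_vupd; rewrite ?scratch1.
  - by rewrite f1.
  - by rewrite f1.
  - by rewrite f1.
  - exact: leq_trans bn.
  - by rewrite vupd_eq.
move=> N2 V2 cp2 [g1 g2 gacc].
have f1' : frame test_mods N N2.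
  by apply: (frame_trans _ g1) => //; apply: frame_upd.
have f2' : frame scratch V V2.
  apply: (frame_trans _ g2); last by apply/allP.
  by apply: frame_vupd; rewrite ?scratch1.
apply: triple_block_seq => /=.
have c2 := cst_frame hc f1' isT.
have [d0 d3 d14 d15 d16 d17 d18 d19 d20 d21 d26] := c2.
apply: triple_seq_conseq.
  apply: (@sub_loop_spec _ _ _ i l p b) => //=.
  - exact: ready_frame hV f2'.
  - by rewrite g1.
  - by rewrite f1'.
  - by rewrite d26 addn0 f1'.
  - by rewrite f1'.
  - by move=> j hj; rewrite f2' ?hC // aC_notin //; case/andP: hj.
move=> N3 V3 cp3 [g3 g4 gacc'].
have f1'' : frame test_mods N N3.
  by apply: (frame_trans _ g3) => //; apply: frame_upd.
have f2'' : frame scratch V V3.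
  by apply: (frame_trans f2' g4); apply/allP.
have [e0 e3 e14 e15 e16 e17 e18 e19 e20 e21 e26] := cst_frame hc f1'' isT.
have hz : V3 (aS 0) = 0 by have [] := ready_frame hV f2''.
have hacc : V3 (aS 1) = esum i l p b by rewrite gacc' gacc dot_sums.
have e5 : N3 5 = l by rewrite g3 //= g1.
have e13 : N3 13 = N1 13 by rewrite g3 //= g1.
have hasS : has (fun l => esum i l p b != 0) (iota 0 l.+1) =
    (N1 13 != 0%N) || (esum i l p b != 0).
  by rewrite -addn1 iotaD has_cat /= orbF f13 eqb0 negbK.
apply: triple_if => /=; rewrite e17 e18 hz hacc => hb.
  apply: triple_le (_ : 0 <= 1)%N _ => //; apply: triple_block => /=.
  split=> //; first by do 3?[apply: frame_upd => //].
    by rewrite /= e5 addn1.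
  by rewrite hasS hb orbF /= e13 f13 eqb0 negbK.
apply: triple_block => /=.
split=> //; first by do 3?[apply: frame_upd => //].
  by rewrite /= e5 addn1.
by rewrite hasS hb orbT.
Qed.

(** * Recomputing one entry *)

Definition entry i j : R := \sum_(0 <= t < n) V0 (aA i t) * V0 (aB t j).
Definition has_err i p b := has (fun j => err i j != 0) (index_iota p b).
Definition crow i := [seq aC i j | j <- iota 0 n].
Definition fix_cost := (n * 11 + 8)%N.

Lemma err0_entry i j : err i j = 0 -> V0 (aC i j) = entry i j.
Proof. by move/eqP; rewrite subr_eq0 => /eqP. Qed.

Lemma fix_entry_spec N V cp i lo : cst N -> ready V ->
  N 8 = i -> N 11 = lo -> (i < n)%N -> (lo < n)%N ->
  triple fix_entry N V cp fix_cost (fun N' V' cp' =>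
    [/\ frame [:: 2; 7; 22; 23]%N N N', frame (aC i lo :: scratch) V V' &
      V' (aC i lo) = entry i lo]).
Proof.
move=> hc hV h8 h11 hi hlo.
set I := fun t N' V' (cp' : nat) => [/\ frame [:: 2; 7; 22; 23]%N N N',
  frame scratch V V', N' 7 = t & V' (aS 1) =
  \sum_(0 <= t' < t) V0 (aA i t') * V0 (aB t' lo)].
apply: (@triple_le _ _ _ _ _ _ (2 + ((n - 0) * (7 + 4) + 2 + 4))).
  by rewrite /fix_cost; nia.
apply: triple_block_seq => /=.
have [c0 c3 c14 c15 c16 c17 c18 c19 c20 c21 c26] := hc.
rewrite c18.
apply: (triple_seq_conseq (Q1 := I n)).
  apply: triple_loop_const => //.
  - split=> //; first by apply: frame_upd.
      by apply: frame_vupd; rewrite ?scratch1.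
    by rewrite vupd_eq big_geq.
  - move=> t N' V' cp' [f1 f2 -> _]; split=> //.
    by have [] := cst_frame hc f1 isT.
  move=> t N' V' cp' /andP[_ ht] [f1 f2 f7 facc].
  have [d0 d3 d14 d15 d16 d17 d18 d19 d20 d21 d26] := cst_frame hc f1 isT.
  have [r1 r2 r3 r4] := ready_frame hV f2.
  apply: triple_block => /=.
  rewrite d0 d15 d18 d19 (f1 8%N isT) (f1 11%N isT) f7 h8 h11.
  rewrite -/(aA i t) -/(aB t lo).
  split=> //=; rewrite ?addn1 //.
  - by do 13?[apply: frame_upd => //].
  - by do 2![apply: frame_vupd; rewrite ?scratch1 ?scratch2 //].
  rewrite !vupd_eq !(vupd_ne _ _ aS12) facc big_nat_recr //= !r1 //.
    exact: aB_lt.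
  by have := aA_lt hi ht; lia.
move=> N1 V1 cp1 [f1 f2 f7 facc].
have [d0 d3 d14 d15 d16 d17 d18 d19 d20 d21 d26] := cst_frame hc f1 isT.
apply: triple_block => /=.
rewrite d0 d16 d18 (f1 8%N isT) (f1 11%N isT) h8 h11 -/(aC i lo).
split; last by rewrite vupd_eq facc.
- by do 13?[apply: frame_upd => //].
- apply: frame_vupd; last by rewrite mem_head.
  by move=> x; rewrite inE negb_or => /andP[_]; apply: f2.
Qed.

(** The good event of the coins, on which search and correction are shown to be exact. *)
Hypothesis good : forall i p b, (i < n)%N -> (b <= n)%N -> has_err i p b ->
  has (fun l => esum i l p b != 0) (iota 0 L).

(** The error of the test is one-sided: in an error-free interval every term of [esum] vanishes,
    whatever the coins. *)
Lemma good_test i p b : (i < n)%N -> (b <= n)%N ->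
  has (fun l => esum i l p b != 0) (iota 0 L) = has_err i p b.
Proof.
move=> hi hb; apply/idP/idP; last exact: good.
apply: contraTT; rewrite -!all_predC => /allP h; apply/allP => l _ /=.
rewrite negbK /esum big_nat_cond big1 // => j /andP[hj _].
by have := h j; rewrite mem_index_iota hj /= negbK => /(_ isT) /eqP ->; rewrite mul0r.
Qed.

Lemma has_errS i p b : (p <= b)%N ->
  has_err i p b.+1 = has_err i p b || (err i b != 0).
Proof.
by move=> pb; rewrite /has_err /index_iota subSn // -addn1 iotaD has_cat /= orbF
  subnKC.
Qed.

(** * Binary search for the leftmost error *)

Definition search_mods : seq nat := [:: 2; 5; 6; 7; 10; 11; 12; 13; 22; 23]%N.
Definition search_cost := (lg n * (test_cost + 10) + 6)%N.

Definition search_post i p N V N' V' := exists lo, [/\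
  frame search_mods N N' /\ frame scratch V V', N' 11 = lo, N' 12 = lo.+1,
  (p <= lo < n)%N & ~~ has_err i p lo /\ err i lo != 0].

(** Invariant: there is no error in columns [p] to [lo - 1] and one in columns [p] to [hi - 1]. Once
    [hi = lo + 1], column [lo] is the leftmost error. Since [n < 2 ^ lg n], [lg n] halvings
    suffice. *)
Lemma search_spec N V cp i p : cst N -> ready V ->
  N 8 = i -> N 9 = p -> (i < n)%N -> (p <= n)%N -> has_err i p n ->
  (forall j, (p <= j < n)%N -> V (aC i j) = V0 (aC i j)) ->
  triple search N V cp search_cost (fun N' V' _ => search_post i p N V N' V').
Proof.
move=> hc hV h8 h9 lt_in pn hpn hC.
rewrite /search_cost -[6%N]/(2 + 4)%N addnA addnC.
apply: triple_block_seq => /=.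
have [c0 c3 c14 c15 c16 c17 c18 c19 c20 c21 c26] := hc.
rewrite c0 c26 h9 !addn0 addn1.
set c := Seq _ _; set N1 := (X in triple _ X).
have lt_pn : (p < n)%N.
  rewrite ltn_neqAle pn andbT; apply: contraTN hpn => /eqP->.
  by rewrite /has_err /index_iota subnn.
(* Here [m] bounds the number of rounds still to come. *)
suff loop m : forall lo hi N' V' cp', frame search_mods N N' ->
    frame scratch V V' -> N' 11 = lo -> N' 12 = hi -> N' 22 = lo.+1 ->
    (p <= lo < hi)%N -> (hi <= n)%N -> (hi - lo <= 2 ^ m)%N ->
    ~~ has_err i p lo -> has_err i p hi ->
    triple (While (CNLt 22 12) c) N' V' cp' (m * (test_cost + 10) + 2)
      (fun N' V' _ => search_post i p N V N' V').
  apply: (loop _ p n) => //.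
  - by do 4?[apply: frame_upd => //].
  - by rewrite leqnn.
  - by apply: leq_trans (leq_subr _ _) (ltnW _); apply: trunc_log_ltn.
  - by rewrite /has_err /index_iota subnn.
have stop lo hi N' V' cp' k : frame search_mods N N' -> frame scratch V V' ->
    N' 11 = lo -> N' 12 = hi -> N' 22 = lo.+1 -> (p <= lo < hi)%N -> (hi <= n)%N ->
    ~~ has_err i p lo -> has_err i p hi -> ~~ (lo.+1 < hi)%N ->
    triple (While (CNLt 22 12) c) N' V' cp' (k + 2)
      (fun N' V' _ => search_post i p N V N' V').
  move=> f1 f2 f11 f12 f22 /andP[pl lh] hn nlo yhi hs.
  apply: (@triple_le _ _ _ _ _ _ 2); first by lia.
  have ehi : hi = lo.+1 by lia.
  apply: triple_while_false; first by rewrite /= f22 f12.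
  exists lo; split=> //; [by rewrite f12 | by rewrite pl; lia | split=> //].
  by move: yhi; rewrite ehi has_errS // (negbTE nlo).
elim: m => [|m IH] lo hi N' V' cp' f1 f2 f11 f12 f22 plh hn hm nlo yhi.
  by apply: (stop lo hi) => //; move: hm plh; rewrite expn0; lia.
case: (boolP (lo.+1 < hi)%N) => hs; last exact: (stop lo hi).
apply: (@triple_le _ _ _ _ _ _
   (3 + (test_cost + (1 + 2 + 2)) + (m * (test_cost + 10) + 2) + 2)).
  by rewrite mulSn; lia.
apply: triple_while_true; first by rewrite /= f22 f12.
have cN' := cst_frame hc f1 isT.
have [d0 d3 d14 d15 d16 d17 d18 d19 d20 d21 d26] := cN'.
apply: triple_block_seq => /=; rewrite f11 f12.
set mid := (_ %/ 2)%N.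
(* Since [lo + 1 < hi], both halves are nonempty, so the bounds stay ordered in either branch. *)
have [h1 h2] : (lo < mid)%N /\ (mid < hi)%N by rewrite /mid; split; lia.
have [h3 h4] : (mid - lo <= 2 ^ m)%N /\ (hi - mid <= 2 ^ m)%N.
  by move: hm; rewrite expnS /mid; split; lia.
apply: triple_seq_conseq.
  apply: (@test_spec _ _ _ i p mid) => //=; try (by rewrite f1); try lia.
  - exact: ready_frame hV f2.
  - by move=> j hj; rewrite f2 ?hC // aC_notin //; case/andP: hj.
rewrite good_test //; last by lia.
move=> N2 V2 cp2 [g1 g2 g13].
have f1' : frame search_mods N N2.
  by apply: (frame_trans _ g1) => //; do 5?[apply: frame_upd => //].
have f2' : frame scratch V V2.
  by apply: (frame_trans f2 g2); apply/allP.
have [e0 e3 e14 e15 e16 e17 e18 e19 e20 e21 e26] := cst_frame hc f1' isT.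
have e10 : N2 10 = mid by rewrite g1.
have e11 : N2 11 = lo by rewrite g1.
have e12 : N2 12 = hi by rewrite g1.
apply: triple_seq; apply: triple_if => /=; rewrite e26 g13 lt0b => hb.
  apply: triple_block => /=; rewrite e10 e26 addn0.
  apply: (@triple_block _ _ [:: NConst 2 1; NAdd 22 11 2]) => /=.
  rewrite e11 addn1; apply: (IH lo mid) => //=; try lia.
  by do 5?[apply: frame_upd => //].
apply: triple_block => /=; rewrite e10 e26 addn0.
apply: (@triple_block _ _ [:: NConst 2 1; NAdd 22 11 2]) => /=.
rewrite addn1; apply: (IH mid hi) => //=; try lia.
by do 5?[apply: frame_upd => //].
Qed.

(** * Correcting one row, then all rows *)

Definition nerr i p := count (fun j => err i j != 0) (index_iota p n).

(** Moving [p] past the leftmost error uses up exactly one error, which bounds the rounds spent on a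
    row. *)
Lemma nerr_split i p lo : (p <= lo < n)%N -> ~~ has_err i p lo ->
  err i lo != 0 -> nerr i p = (nerr i lo.+1).+1.
Proof.
move=> /andP[pl ln] /hasPn nh he; rewrite /nerr.
have -> : index_iota p n = index_iota p lo ++ lo :: index_iota lo.+1 n.
  rewrite /index_iota -[lo :: _]/(iota lo (n - lo.+1).+1) -subSn // subSS.
  by rewrite -{2}(subnKC pl) -iotaD; congr iota; lia.
by rewrite count_cat /= he (@eq_in_count _ _ pred0) ?count_pred0 // => j /nh /negbTE.
Qed.

Lemma aC_inj i i' j j' : (j < n)%N -> (j' < n)%N -> aC i j = aC i' j' ->
  i = i' /\ j = j'.
Proof. by move=> hj hj' /addIn /row_major_inj; apply. Qed.

Lemma mem_crow i j : (j < n)%N -> aC i j \in crow i.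
Proof. by move=> hj; apply: map_f; rewrite mem_iota. Qed.

Lemma crow_ready i : (i < n)%N ->
  all (fun x => (n * n + n * n <= x < aS 3)%N && (x != aS 0)) (crow i ++ scratch).
Proof.
move=> hi; rewrite all_cat; apply/andP; split; last by rewrite /= /aS; lia.
apply/allP => x /mapP[j]; rewrite mem_iota => /andP[_ hj] ->.
by have := aC_lt hi hj; have := aC_ge i j; rewrite /aS; lia.
Qed.

Definition row_mods : seq nat := [:: 2; 5; 6; 7; 9; 10; 11; 12; 13; 22; 23]%N.
Definition entry_cost := (search_cost + (fix_cost + (2 + test_cost)) + 2)%N.

Lemma row_spec N V cp i : cst N -> ready V -> N 8 = i -> (i < n)%N ->
  (forall j, (j < n)%N -> V (aC i j) = V0 (aC i j)) ->
  triple row N V cp (4 + test_cost + nerr i 0 * entry_cost)%N (fun N' V' cp' =>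
    [/\ frame row_mods N N', frame (crow i ++ scratch) V V' &
      forall j, (j < n)%N -> V' (aC i j) = entry i j]).
Proof.
move=> hc hV h8 lt_in hC.
apply: (@triple_le _ _ _ _ _ _ (2 + (test_cost + (nerr i 0 * entry_cost + 2)))).
  by lia.
have [c0 _ _ _ _ _ _ _ _ _ c26] := hc.
apply: triple_block_seq => /=; rewrite c0 c26 addn0.
apply: triple_seq_conseq.
  by apply: (@test_spec _ _ _ i 0 n) => // j /andP[_]; apply: hC.
move=> N1 V1 cp1; rewrite good_test // => -[g1 g2 g13].
have f1 : frame row_mods N N1.
  by apply: (frame_trans _ g1) => //; do 5?[apply: frame_upd => //].
have f2 : frame (crow i ++ scratch) V V1.
  by move=> x; rewrite mem_cat negb_or => /andP[_ hx]; rewrite g2.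
set body := (X in While _ X).
(* Induction on the number [e] of errors from column [p] on. Columns before [p] already hold the
   product, the others their initial entries. *)
suff loop e : forall p N1 V1 cp1, nerr i p = e -> (p <= n)%N ->
    frame row_mods N N1 -> frame (crow i ++ scratch) V V1 ->
    N1 9%N = p -> N1 13%N = has_err i p n ->
    (forall j, (j < p)%N -> V1 (aC i j) = entry i j) ->
    (forall j, (p <= j < n)%N -> V1 (aC i j) = V0 (aC i j)) ->
    triple (While (CNLt 26 13) body) N1 V1 cp1 (e * entry_cost + 2)
      (fun N' V' cp' => [/\ frame row_mods N N',
         frame (crow i ++ scratch) V V' &
         forall j, (j < n)%N -> V' (aC i j) = entry i j]).
  apply: (loop _ 0%N) => //; first by rewrite g1.
  by move=> j /andP[_ hj]; rewrite g2 ?hC // aC_notin.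
elim: e => [|e IH] p {g1 g2 g13 f1 f2}N1 {}V1 {}cp1 he pn f1 f2 h9 g13 hdone htodo;
  have cN1 := cst_frame hc f1 isT; have [d0 _ _ _ _ _ _ _ _ _ d26] := cN1.
  have nh : ~~ has_err i p n by rewrite /has_err has_count -/(nerr i p) he.
  apply: triple_while_false; first by rewrite /= d26 g13 (negbTE nh).
  split=> // j hj; case: (ltnP j p) => hjp; first exact: hdone.
  rewrite htodo ?hjp // err0_entry //; apply/eqP.
  by move/hasPn: nh => /(_ j); rewrite mem_index_iota hjp hj negbK; apply.
have yh : has_err i p n by rewrite /has_err has_count -/(nerr i p) he.
apply: (@triple_le _ _ _ _ _ _
  (search_cost + (fix_cost + (2 + test_cost)) + (e * entry_cost + 2) + 2)).
  by rewrite mulSn {2}/entry_cost; lia.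
apply: triple_while_true; first by rewrite /= d26 g13 yh.
have hV1 := ready_frame_all hV f2 (crow_ready lt_in).
apply: triple_seq_conseq.
  apply: (@search_spec _ _ _ i p) => //.
  by rewrite f1.
move=> N2 V2 cp2 [lo [[g1 g2] e11 e12 /andP[plo lon] [nlo ylo]]].
apply: triple_seq_conseq.
  apply: (@fix_entry_spec _ _ _ i lo) => //.
  - exact: cst_frame cN1 g1 isT.
  - exact: ready_frame hV1 g2.
  - by rewrite g1 //= f1.
move=> N3 V3 cp3 [g3 g4 hlo].
have f1' : frame row_mods N N3.
  by apply: (frame_trans _ g3) => //; apply: (frame_trans f1 g1).
have f2' : frame (crow i ++ scratch) V V3.
  apply: (frame_trans _ g4); last first.
    by rewrite /= !mem_cat mem_crow //= scratch1 scratch2 !orbT.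
  apply: (frame_trans f2 g2).
  by rewrite /= !mem_cat scratch1 scratch2 !orbT.
have V31 j : (j < n)%N -> j != lo -> V3 (aC i j) = V1 (aC i j).
  move=> hj jlo; rewrite g4 ?g2 ?aC_notin // inE negb_or aC_notin // andbT.
  by apply: contra jlo => /eqP /aC_inj[] // _ ->.
(* Columns from [p] to [lo - 1] were never changed, but they contain no error, so they hold the
   product too. *)
have hdone' j : (j < lo.+1)%N -> V3 (aC i j) = entry i j.
  rewrite ltnS leq_eqVlt => /predU1P[-> //|jlo].
  have jn := ltn_trans jlo lon.
  rewrite V31 //; last by rewrite neq_ltn jlo.
  case: (ltnP j p) => hjp; first exact: hdone.
  rewrite htodo ?hjp // err0_entry //; apply/eqP.
  by move/hasPn: nlo => /(_ j); rewrite mem_index_iota hjp jlo negbK; apply.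
have htodo' j : (lo.+1 <= j < n)%N -> V3 (aC i j) = V0 (aC i j).
  move=> /andP[loj hj]; rewrite V31 ?htodo //; last by lia.
  by rewrite hj andbT; lia.
apply: triple_block_seq => /=.
have cN3 := cst_frame hc f1' isT; have [k0 _ _ _ _ _ _ _ _ _ k26] := cN3.
rewrite k0 k26 !addn0 (g3 12%N isT) e12.
apply: triple_conseq (leqnn _) _.
  apply: (@test_spec _ _ _ i lo.+1 n) => //=.
  - exact: ready_frame_all hV f2' (crow_ready lt_in).
  - by rewrite f1'.
rewrite good_test // => N4 V4 cp4 [g5 g6 g13'].
apply: (IH lo.+1) => //.
- by apply/eqP; rewrite -eqSS -he (@nerr_split i p lo) // plo.
- by apply: (frame_trans _ g5) => //; do 5?[apply: frame_upd => //].
- apply: (frame_trans f2' g6).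
  by rewrite /= !mem_cat scratch1 scratch2 !orbT.
- by rewrite g5.
- move=> j hj; rewrite g6 ?hdone' // aC_notin //.
  exact: leq_trans hj lon.
- by move=> j hj; rewrite g6 ?htodo' // aC_notin //; case/andP: hj.
Qed.

Definition rows_mods : seq nat := 8%N :: row_mods.

Lemma rows_spec N V cp : cst N -> ready V -> N 8 = 0%N ->
  (forall i j, (i < n)%N -> (j < n)%N -> V (aC i j) = V0 (aC i j)) ->
  triple (Loop 8 0 row) N V cp
    (\sum_(0 <= i < n) (4 + test_cost + nerr i 0 * entry_cost + 4) + 2)%N
    (fun N' V' cp' =>
      forall i j, (i < n)%N -> (j < n)%N -> V' (aC i j) = entry i j).
Proof.
move=> hc hV h8 hC.
set I := fun i N' V' (cp' : nat) => [/\ frame rows_mods N N', ready V', N' 8 = i,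
  forall i' j, (i' < i)%N -> (i' < n)%N -> (j < n)%N -> V' (aC i' j) = entry i' j &
  forall i' j, (i <= i')%N -> (i' < n)%N -> (j < n)%N -> V' (aC i' j) = V0 (aC i' j)].
apply: triple_conseq (leqnn _) (_ : forall N' V' cp', I n N' V' cp' -> _);
  last by move=> N' V' cp' [_ _ _ h _] i j hi hj; apply: h.
apply: (@triple_loop _ _ 8 0 row I) => //.
- by split=> // i' j _; apply: hC.
- move=> i N' V' cp' [f1 _ -> _ _]; split=> //.
  by have [] := cst_frame hc f1 isT.
move=> i N1 V1 cp1 /andP[_ lt_in] [f1 hV1 e8 hdone htodo].
apply: triple_conseq (leqnn _) _.
  apply: (@row_spec _ _ _ i) => //; first exact: cst_frame hc f1 isT.
  by move=> j hj; apply: htodo.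
move=> N2 V2 cp2 [g1 g2 hrow] /=; rewrite (g1 8%N isT) e8 addn1.
have other i' j : i' != i -> (i' < n)%N -> (j < n)%N -> V2 (aC i' j) = V1 (aC i' j).
  move=> ii hi' hj; apply: g2; rewrite mem_cat negb_or aC_notin // andbT.
  apply: contra ii => /mapP[j']; rewrite mem_iota => /andP[_ hj'].
  by case/aC_inj => // ->.
split=> //.
- by do 2![apply: frame_upd => //]; apply: (frame_trans f1 g1).
- exact: ready_frame_all hV1 g2 (crow_ready lt_in).
- move=> i' j hi' hin hj; case: (eqVneq i' i) => [->|ne]; first exact: hrow.
  by rewrite other // hdone //; lia.
- move=> i' j hi' hin hj; rewrite other ?htodo //; last by lia.
  by lia.
Qed.

(** * The tables of random vectors and prefix sums *)

Lemma aP_S l j t : (aP l j t + n)%N = aP l j.+1 t.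
Proof. by rewrite /aP addnS mulSn; lia. Qed.

Lemma aP_inj l j t l' j' t' : (j <= n)%N -> (j' <= n)%N -> (t < n)%N ->
  (t' < n)%N -> aP l j t = aP l' j' t' -> [/\ l = l', j = j' & t = t'].
Proof.
by move=> hj hj' ht ht' /addIn /row_major_inj[] // /row_major_inj[] // -> -> ->.
Qed.

Definition pcol l j := [seq aP l j t | t <- iota 0 n].

Lemma prefix_loop_spec N V cp l j : cst N -> N 5 = l -> N 6 = j -> N 7 = 0%N ->
  N 22 = aR l j -> (l < L)%N -> (j < n)%N ->
  (forall x, (x <= aS 0)%N -> V x = V0 x) -> V (aR l j) = rv l j ->
  (forall t, (t < n)%N -> V (aP l j t) = psum l j t) ->
  triple prefix_loop N V cp (n * 15 + 2) (fun N' V' cp' =>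
    [/\ frame [:: 2; 7; 23; 24]%N N N', frame (aS 2 :: pcol l j.+1) V V',
      cp' = cp & forall t, (t < n)%N -> V' (aP l j.+1 t) = psum l j.+1 t]).
Proof.
move=> hc h5 h6 h7 h22 hl hj hin hr hP.
set I := fun t N' V' (cp' : nat) => [/\ frame [:: 2; 7; 23; 24]%N N N',
  frame (aS 2 :: pcol l j.+1) V V', N' 7 = t, cp' = cp &
  forall t', (t' < t)%N -> (t' < n)%N -> V' (aP l j.+1 t') = psum l j.+1 t'].
apply: (@triple_conseq _ _ _ _ _ _ ((n - 0) * (11 + 4) + 2) _ (I n)) => //;
  [ |lia|by move=> N' V' cp' [? ? ? ? h]; split=> // t ht; apply: h].
apply: triple_loop_const => //.
- by move=> t N' V' cp' [f1 f2 -> _]; split=> //; have [] := cst_frame hc f1 isT.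
move=> t N' V' cp' /andP[_ ht] [f1 f2 f7 fcp fP].
have [c0 c3 c14 c15 c16 c17 c18 c19 c20 c21 c26] := cst_frame hc f1 isT.
have ne2 x : (x <= aS 0)%N || (aS 3 <= x)%N -> x != aS 2 by rewrite /aS; lia.
have hpcol x : (x < aS 3 + L * n)%N -> x \notin pcol l j.+1.
  move=> hx; apply/mapP => -[t' _ e]; move: hx; rewrite e ltnNge.
  by rewrite aP_ge.
have eB : V' (aB t j) = V0 (aB t j).
  have h : (aB t j <= aS 0)%N by have := aB_lt ht hj; rewrite /aS; lia.
  rewrite f2 ?hin // inE negb_or ne2 ?h //= hpcol //.
  by apply: leq_ltn_trans h _; rewrite /aS; lia.
have eR : V' (aR l j) = rv l j.
  by rewrite f2 // inE negb_or ne2 ?aR_ge ?orbT //= hpcol // aR_lt.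
have aPne2 j' t' : aP l j' t' != aS 2 by apply: ne2; have := aP_ge l j' t'; lia.
(* The cells read belong to [j] and the cells written so far to [j + 1], so the old prefix sums are
   intact. *)
have eP : V' (aP l j t) = psum l j t.
  rewrite f2 ?hP // inE negb_or aPne2; apply/mapP => -[t'].
  by rewrite mem_iota => /andP[_ ht'] /aP_inj[]//; [exact: ltnW|lia].
apply: triple_block => /=.
rewrite c0 c14 c15 c19 c21 (f1 5%N isT) (f1 6%N isT) (f1 22%N isT).
rewrite f7 h5 h6 h22 -/(aB t j) -/(aP l j t) aP_S eB eR.
split=> //=; rewrite ?addn1 //.
- by do 13?[apply: frame_upd => //].
- apply: frame_vupd; last by rewrite inE map_f ?orbT // mem_iota.
  by apply: frame_vupd; rewrite ?mem_head.
move=> t' htt' ht'; case: (eqVneq t' t) => [->|ne].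
  by rewrite vupd_eq vupd_eq vupd_ne // eP /psum [RHS]big_nat_recr.
rewrite !vupd_ne ?fP //; first by lia.
by apply: contra ne => /eqP /aP_inj[]// _ _ ->.
Qed.

(** Tables filled up to the pair [(l, j)] in lexicographic order. The prefix sums for zero columns
    are never written: they rely on fresh cells being 0. *)
Definition tab l j V := [/\ forall x, (x <= aS 0)%N -> V x = V0 x,
  forall l' t, (l' < L)%N -> (t < n)%N -> V (aP l' 0 t) = 0,
  forall l' j', (j' < n)%N -> (l' < l)%N || (l' == l) && (j' < j)%N ->
    V (aR l' j') = rv l' j' &
  forall l' j' t, (j' < n)%N -> (t < n)%N ->
    (l' < l)%N || (l' == l) && (j' < j)%N ->
    V (aP l' j'.+1 t) = psum l' j'.+1 t].

Lemma tab_next_row l V : tab l n V -> tab l.+1 0 V.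
Proof.
by case=> h1 h2 h3 h4; split=> // [l' j' hj'|l' j' t hj' ht];
  rewrite ltn0 andbF orbF => hl; [apply: h3|apply: h4] => //; rewrite hj'; lia.
Qed.

Lemma tab_next l j V V' : (l < L)%N -> (j < n)%N -> tab l j V ->
  frame (aR l j :: aS 2 :: pcol l j.+1) V V' -> V' (aR l j) = rv l j ->
  (forall t, (t < n)%N -> V' (aP l j.+1 t) = psum l j.+1 t) -> tab l j.+1 V'.
Proof.
move=> hl hj [h1 h2 h3 h4] hf hr hP.
have keep_low x : (x < aS 3 + L * n)%N -> x != aS 2 -> x != aR l j -> V' x = V x.
  move=> hx n2 nr; apply: hf; rewrite !inE !negb_or n2 nr /=.
  by apply/mapP => -[t _ e]; move: hx; rewrite e ltnNge aP_ge.
have keep_P l' j' t : (j' <= n)%N -> (t < n)%N -> (l', j') != (l, j.+1) ->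
    V' (aP l' j' t) = V (aP l' j' t).
  move=> hj' ht ne; have := aP_ge l' j' t; have := aR_lt hl hj => hRl hPg.
  apply: hf; rewrite !inE !negb_or; apply/and3P; split.
  - by lia.
  - by move: hPg; rewrite /aS; lia.
  apply/mapP => -[t']; rewrite mem_iota => /andP[_ ht'] /aP_inj[]// e1 e2 _.
  by rewrite e1 e2 eqxx in ne.
split.
- move=> x hx; have hR := aR_ge l j.
  by rewrite keep_low ?h1 //; move: hx hR; rewrite /aS; lia.
- by move=> l' t hl' ht; rewrite keep_P ?h2 // xpair_eqE /= andbF.
- move=> l' j' hj' hlj; case: (eqVneq (l', j') (l, j)) => [[-> ->] //|ne].
  have hl' : (l' < L)%N by lia.
  have hne : (l' < l)%N || (l' == l) && (j' < j)%N.
    by move: ne; rewrite xpair_eqE; lia.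
  rewrite keep_low ?h3 //; first exact: aR_lt.
  - by have := aR_ge l' j'; rewrite /aS; lia.
  by apply: contra ne => /eqP /addIn /row_major_inj[] // -> ->.
- move=> l' j' t hj' ht hlj; case: (eqVneq (l', j') (l, j)) => [[-> ->] |ne].
    exact: hP.
  have hne : (l' < l)%N || (l' == l) && (j' < j)%N.
    by move: ne; rewrite xpair_eqE; lia.
  by rewrite keep_P ?h4.
Qed.

Lemma tab_ready V : V0 (aS 0) = 0 -> tab L 0 V -> ready V.
Proof.
move=> z [h1 h2 h3 h4]; split.
- by move=> x hx; apply: h1; rewrite /aS; lia.
- by rewrite h1.
- by move=> l j hl hj; apply: h3; rewrite ?hl.
- move=> l [|j] t hl hj ht; first by rewrite h2 // /psum big_geq.
  by apply: h4; rewrite ?hl.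
Qed.

Definition tables_mods : seq nat := [:: 2; 5; 6; 7; 22; 23; 24]%N.
Definition tables_cost := (L * (n * (n * 15 + 15) + 7) + 3)%N.

(** The invariants fix the coin position at [l * n + j], which identifies the coin drawn with the
    one that defines [rv l j]. *)
Lemma tables_spec N : cst N -> (forall x, (aS 0 <= x)%N -> V0 x = 0) ->
  triple tables N V0 0 tables_cost (fun N' V' cp' =>
    [/\ frame tables_mods N N', ready V' &
      forall i j, (i < n)%N -> (j < n)%N -> V' (aC i j) = V0 (aC i j)]).
Proof.
move=> hc hz.
set I := fun l N' V' (cp' : nat) => [/\ frame tables_mods N N', N' 5 = l,
  cp' = (l * n)%N & tab l 0 V'].
apply: (@triple_conseq _ _ _ _ _ _
  (1 + ((L - 0) * (1 + ((n - 0) * (5 + ((1 + 2) + (1 + (n * 15 + 2))) + 4) + 2) + 4)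
   + 2)) _ (I L)).
- apply: triple_block_seq => /=.
  apply: triple_loop_const => //.
  + split=> //; first by apply: frame_upd.
    split=> // [l' t _ _|l' j' _|l' j' t _ _]; last 2 first.
    * by rewrite ltn0 andbF.
    * by rewrite ltn0 andbF.
    by apply: hz; have := aP_ge l' 0 t; rewrite /aS; lia.
  + move=> l N' V' cp' [f1 f5 _ _]; split=> //.
    by have [] := cst_frame hc f1 isT.
  move=> l N1 V1 cp1 /andP[_ hl] [f1 f5 -> ht1].
  apply: triple_block_seq => /=.
  set J := fun j N' V' (cp' : nat) => [/\ frame tables_mods N N', N' 5 = l,
    N' 6 = j, cp' = (l * n + j)%N & tab l j V'].
  apply: triple_conseq (leqnn _) (_ : forall N' V' cp', J n N' V' cp' -> _);
    last first.
    move=> N' V' cp' [g1 g5 g6 -> g] /=; split=> //=.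
    - by do 2![apply: frame_upd => //].
    - by rewrite g5 addn1.
    - by rewrite mulSn addnC.
    - exact: tab_next_row.
  apply: triple_loop_const => //.
  + by split=> //; [apply: frame_upd | rewrite addn0].
  + move=> j N' V' cp' [g1 _ -> _ _]; split=> //.
    by have [] := cst_frame hc g1 isT.
  move=> j {f1 f5 ht1}N1 {}V1 {}cp1 /andP[_ hj] [f1 f5 f6 -> ht1].
  have c1 := cst_frame hc f1 isT.
  have [c0 c3 c14 c15 c16 c17 c18 c19 c20 c21 c26] := c1.
  apply: triple_block_seq => /=; rewrite c0 c20 f5 f6 -/(aR l j).
  set N2 := upd (upd (upd (upd _ _ _) _ _) _ _) _ _.
  have f2 : frame tables_mods N N2 by do 4![apply: frame_upd => //].
  apply: (triple_seq_conseq (Q1 := fun N' V' cp' =>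
    [/\ N' = N2, frame [:: aR l j] V1 V', V' (aR l j) = rv l j &
        cp' = (l * n + j).+1])).
    apply: triple_if; rewrite /N2 /= c26 /rv; case: (coins _) => // _.
    - apply: triple_block => /=; split=> //; rewrite ?vupd_eq //.
      by do 2![apply: frame_vupd; rewrite ?mem_head //].
    - apply: triple_le (_ : 0 <= 1)%N _ => //; apply: triple_block => /=.
      split=> //; rewrite ?vupd_eq //.
      by apply: frame_vupd; rewrite ?mem_head.
  move=> _ V3 _ [-> g1 g2 ->].
  have [t1 t2 t3 t4] := ht1.
  apply: triple_block_seq => /=.
  have aRne x : (x <= aS 0)%N || (aS 3 + L * n <= x)%N -> x \notin [:: aR l j].
    by have := aR_ge l j; have := aR_lt hl hj; rewrite inE /aS; lia.
  apply: triple_conseq (leqnn _) _.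
    apply: (@prefix_loop_spec _ _ _ l j) => //=.
    - by move=> x hx; rewrite g1 ?t1 // aRne // hx.
    - move=> t ht; rewrite g1 ?aRne ?aP_ge ?orbT //.
      case: j hj t3 t4 {ht1 f6 N2 f2 g1 g2 aRne} => [|j] hj t3 t4.
        by rewrite t2 // /psum big_geq.
      by apply: t4; rewrite ?eqxx ?leqnn ?orbT //; exact: ltnW.
  move=> N4 V4 _ [g3 g4 -> g5] /=.
  split=> //=.
  + do 2![apply: frame_upd => //]; apply: (frame_trans _ g3) => //.
    by do 5![apply: frame_upd => //].
  + by rewrite g3.
  + by rewrite g3 // /N2 /= f6 addn1.
  + by rewrite addnS.
  apply: (tab_next hl hj ht1) => //.
  - apply: (frame_trans (_ : frame _ V1 V3) g4).
      by move=> x; rewrite inE negb_or => /andP[hx _]; apply: g1; rewrite inE.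
    by apply/allP => x hx /=; rewrite inE hx orbT.
  rewrite g4 //; have h1 := aR_lt hl hj; have h2 := aR_ge l j.
  rewrite inE negb_or; apply/andP; split; first by move: h2; rewrite /aS; lia.
  by apply/mapP => -[t _ e]; move: h1; rewrite e ltnNge aP_ge.
- by rewrite /tables_cost; nia.
move=> N' V' cp' [f1 _ _ ht]; split=> //; first exact: tab_ready (hz _ _) ht.
by move=> i j hi hj; have [h _ _ _] := ht; apply/h/ltnW/aC_lt.
Qed.

(** * Initialization and the whole program *)

Definition init_cost := (lg n * 4 + 15)%N.

Lemma init_spec D k V cp : (0 < n)%N -> L = (D * lg n)%N ->
  triple (init D) (upd (upd (fun=> 0%N) 0 n) 1 k) V cp init_cost
    (fun N' V' cp' => [/\ cst N', V' = V & cp' = cp]).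
Proof.
move=> n0 hL; set N := upd _ _ _.
apply: (@triple_le _ _ _ _ _ _ (4 + (lg n * 4 + 2 + 9))).
  by rewrite /init_cost; lia.
apply: triple_block_seq => /=.
apply: (triple_seq_conseq (Q1 := fun N' V' cp' => [/\ N' 0%N = n, N' 3%N = L,
  N' 14%N = n.+1 /\ N' 26%N = 0%N, V' = V & cp' = cp])); last first.
  move=> N' V' cp' [h0 h3 [h14 h26] -> ->]; apply: triple_block => /=.
  rewrite h0 h3; split=> //; rewrite /cst /= h0 h3 h14 h26 /aS.
  by rewrite !addn0 !addn1 !addn2 !addn3.
(* After [m] rounds register 4 is [2 ^ m]. The first power above [n] is reached at [m = lg n], when
   register 3 has become [D * lg n]. *)
suff loop q : forall m N', (m + q = lg n)%N -> N' 0%N = n -> N' 3%N = (D * m)%N ->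
    N' 4%N = (2 ^ m)%N -> N' 14%N = n.+1 -> N' 25%N = D -> N' 26%N = 0%N ->
    triple (While (CNLt 4 14) (Block [:: NAdd 4 4 4; NAdd 3 3 25])) N' V cp
     (q * 4 + 2) (fun N' V' cp' => [/\ N' 0%N = n, N' 3%N = L,
       N' 14%N = n.+1 /\ N' 26%N = 0%N, V' = V & cp' = cp]).
  by apply: (loop _ 0%N) => //=; rewrite ?muln0 ?addn1.
elim: q => [|q IH] m N' hm h0 h3 h4 h14 h25 h26.
  rewrite addn0 in hm; apply: triple_while_false.
    by rewrite /= h4 h14 hm ltnS -ltnNge trunc_log_ltn.
  by split; rewrite ?h3 ?hL ?hm.
apply: (@triple_le _ _ _ _ _ _ (2 + (q * 4 + 2) + 2)); first by lia.
apply: triple_while_true.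
  rewrite /= h4 h14 ltnS; apply: leq_trans (_ : 2 ^ trunc_log 2 n <= _)%N.
    by rewrite leq_exp2l //; move: hm; rewrite /lg; lia.
  exact: trunc_logP.
apply: triple_block => /=; apply: (IH m.+1) => //=; first by lia.
  by rewrite h3 h25 mulnS addnC.
by rewrite h4 expnS mul2n addnn.
Qed.

Definition total_cost :=
  (init_cost + (tables_cost + (1 +
    (\sum_(0 <= i < n) (4 + test_cost + nerr i 0 * entry_cost + 4) + 2))))%N.

Lemma correct_product_spec D k : (0 < n)%N -> L = (D * lg n)%N ->
  (forall x, (aS 0 <= x)%N -> V0 x = 0) ->
  triple (correct_product D) (upd (upd (fun=> 0%N) 0 n) 1 k) V0 0 total_cost
    (fun N' V' cp' =>
      forall i j, (i < n)%N -> (j < n)%N -> V' (aC i j) = entry i j).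
Proof.
move=> n0 hL hz; apply: (triple_seq_conseq (init_spec _ _ _ n0 hL)).
move=> N1 _ _ [c1 -> ->]; apply: (triple_seq_conseq (tables_spec c1 hz)).
move=> N2 V2 cp2 [f2 r2 hC]; apply: triple_block_seq => /=.
apply: rows_spec => //.
apply: (cst_frame c1 (_ : frame (8%N :: tables_mods) N1 _)) => //.
apply: frame_upd; rewrite ?mem_head // => x; rewrite inE negb_or => /andP[_].
exact: f2.
Qed.
End Spec.

(** * Running time *)

(** If [lg n <= 2 * lg k], the second term suffices. Otherwise [k < 2 ^ q] is small against [n], and
    [m + 1 <= 2 * 2 ^ (m - q)] gives [k * lg n <= 2 * 2 ^ m <= 2 * n]. *)
Lemma mul_lg_le n k : (0 < n)%N -> (k * lg n <= 2 * (n + k * lg k))%N.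
Proof.
move=> n0; set q := lg k; set m := trunc_log 2 n.
have hk : (k < 2 ^ q)%N by apply: trunc_log_ltn.
have hn : (2 ^ m <= n)%N by apply: trunc_logP.
have -> : lg n = m.+1 by [].
case: (leqP m.+1 (2 * q)) => hq; first by have := leq_mul (leqnn k) hq; lia.
have hm : (m = q + (m - q))%N by lia.
have h1 : (m.+1 <= 2 * 2 ^ (m - q))%N.
  by have := ltn_expl (m - q) (isT : (1 < 2)%N); lia.
have h2 : (2 ^ q * (2 * 2 ^ (m - q)) = 2 * 2 ^ m)%N.
  by rewrite mulnCA -expnD -hm.
have := leq_mul (ltnW hk) h1; rewrite h2; lia.
Qed.

(** The inequality is strict to leave one step for [Halt]. *)
Lemma total_cost_bound (R : pzRingType) (n k D : nat) (V0 : nat -> R) :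
  (0 < n)%N -> (0 < D)%N -> (\sum_(0 <= i < n) nerr n V0 i 0 <= k)%N ->
  (total_cost n (D * lg n) V0 < time_bound (500 * D) n k)%N.
Proof.
move=> n0 D0 hk; set l := lg n; have l0 : (0 < l)%N by [].
(* [X] is the order of magnitude of one interval test; an error then costs [O(X * l)] and the tables
   [O(X * n)]. *)
set X := (D * l * n)%N.
have hX : (0 < X)%N by rewrite !muln_gt0 D0 l0.
have hlX : (l <= X)%N by rewrite /X mulnAC leq_pmull // muln_gt0 D0.
have hDlX : (D * l <= X)%N by rewrite leq_pmulr.
have hnX : (n <= X)%N by rewrite leq_pmull // muln_gt0 D0.
have hXn : (X <= X * n)%N by rewrite leq_pmulr.
have hXl : (X <= X * l)%N by rewrite leq_pmulr.
have ht : (test_cost n (D * l) <= 62 * X)%N.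
  by rewrite /test_cost mulnDr mulnCA -/X; lia.
have hi : (init_cost n <= 19 * X)%N by rewrite /init_cost -/l; lia.
have htab : (tables_cost n (D * l) <= 40 * (X * n))%N.
  have h : (D * l * (n * (n * 15 + 15)) = 15 * (X * n) + 15 * X)%N.
    by rewrite /X; lia.
  by rewrite /tables_cost mulnDr h; lia.
have he : (entry_cost n (D * l) <= 170 * (X * l))%N.
  have h : (l * (test_cost n (D * l) + 10) <= 72 * (X * l))%N.
    by have := leq_mul (leqnn l) (_ : test_cost n (D * l) + 10 <= 72 * X)%N; lia.
  by rewrite /entry_cost /search_cost /fix_cost -/l; lia.
set E := entry_cost _ _ in he.
have hs : (\sum_(0 <= i < n) (4 + test_cost n (D * l) + nerr n V0 i 0 * E + 4)
    <= 70 * (X * n) + k * (170 * (X * l)))%N.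
  have h1 := leq_mul hk he; rewrite big_distrl /= in h1.
  move: (test_cost _ _) ht => tc ht.
  rewrite !big_split /= !sum_nat_const_nat subn0.
  have h2 : (n * tc <= 62 * (X * n))%N.
    by have := leq_mul (leqnn n) ht; lia.
  by have h3 := leq_pmull n hX; lia.
(* This trades the factor [lg n] of the binary searches for [lg k]. *)
have hkl := mul_lg_le k n0.
have hll : (k * lg k <= k * lg k * lg (lg k))%N by rewrite leq_pmulr.
rewrite /total_cost -/l -/E.
set S := (\sum_(_ <= _ < _) _)%N in hs *.
have -> : time_bound (500 * D) n k = (500 * (X * (n + k * lg k * lg (lg k))))%N.
  by rewrite /time_bound /X -/l; lia.
have h5 : (X * (k * l) <= X * (2 * (n + k * lg k * lg (lg k))))%N.
  by rewrite leq_mul2l; apply/orP; right; lia.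
by move: h5; rewrite !mulnDr; lia.
Qed.

(** * Probability of failure *)

Section Counting.
Variables (R : pzRingType) (T : nat).
Implicit Types c : {ffun 'I_T -> bool}.

Definition coin_fun c (m : nat) : bool :=
  match (insub m : option 'I_T) with Some i => c i | None => false end.

Lemma coin_funE c m (hm : (m < T)%N) : coin_fun c m = c (Ordinal hm).
Proof. by rewrite /coin_fun insubT. Qed.

Variables (n L p b j0 : nat) (e : nat -> R).
Hypotheses (pj0 : (p <= j0 < b)%N) (bn : (b <= n)%N) (LT : (L * n <= T)%N).
Hypothesis e0 : e j0 != 0.

Definition undetected : {set {ffun 'I_T -> bool}} := [set c |
  all (fun l => \sum_(p <= j < b) e j * (coin_fun c (l * n + j))%:R == 0)
    (iota 0 L)].

(* Flipping the coins of column [j0] in the vectors selected by [s] is injective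
   on pairs (undetected coins, s), because the vectors with a nonzero sum after
   the flip are exactly those selected by [s]. *)
Definition flip c (s : {ffun 'I_L -> bool}) : {ffun 'I_T -> bool} :=
  [ffun x : 'I_T => c x (+) [exists l : 'I_L, s l && (x == l * n + j0 :> nat)%N]].

Lemma coin_fun_flip c s (l : 'I_L) j : (j < n)%N ->
  coin_fun (flip c s) (l * n + j) = coin_fun c (l * n + j) (+) ((j == j0) && s l).
Proof.
move=> hj; have hT : (l * n + j < T)%N by apply: leq_trans LT; apply: row_major_lt.
have j0n : (j0 < n)%N by lia.
rewrite !(coin_funE _ hT) ffunE; congr (_ (+) _).
apply/existsP/andP => [[l' /andP[sl /eqP /= /row_major_inj[]// e1 e2]]|[/eqP ej sl]].
  by rewrite e2 eqxx (val_inj e1 : l = l') sl.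
by exists l; rewrite sl /= ej.
Qed.

(** Subtracting the sum for [c], which is 0, leaves only column [j0]: the difference is [e j0] up to
    sign if [l] is selected, and 0 otherwise. *)
Lemma flip_sum c s (l : 'I_L) : c \in undetected ->
  (\sum_(p <= j < b) e j * (coin_fun (flip c s) (l * n + j))%:R == 0) = ~~ s l.
Proof.
rewrite inE => /allP/(_ l); rewrite mem_iota /= add0n ltn_ord => /(_ isT)/eqP h.
set S := (X in X == 0).
have -> : S = S - \sum_(p <= j < b) e j * (coin_fun c (l * n + j))%:R.
  by rewrite h subr0.
rewrite /S -sumrB (bigD1_seq j0) ?iota_uniq ?mem_index_iota //=.
have j0n : (j0 < n)%N by lia.
rewrite big_seq_cond big1 ?addr0; last first.
  move=> j /andP[]; rewrite mem_index_iota => hj /negbTE ne.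
  by rewrite coin_fun_flip ?ne ?addbF ?subrr //; lia.
rewrite coin_fun_flip // eqxx /=; case: (s l); last by rewrite addbF subrr eqxx.
case: (coin_fun _ _) => /=; rewrite ?mulr0 ?mulr1 ?sub0r ?subr0 ?oppr_eq0.
  exact: negbTE.
exact: negbTE.
Qed.

(** In counting form: an interval with an error escapes all [L] vectors with probability at most
    [2 ^ -L]. *)
Lemma card_undetected : (#|undetected| * 2 ^ L <= 2 ^ T)%N.
Proof.
have -> : (2 ^ L = #|[set: {ffun 'I_L -> bool}]|)%N.
  by rewrite cardsT card_ffun card_bool card_ord.
rewrite -cardsX -(@card_in_imset _ _ (fun x => flip x.1 x.2)).
  by apply: leq_trans (max_card _) _; rewrite card_ffun card_bool card_ord.
move=> [c s] [c' s']; rewrite !in_setX !in_setT !andbT /= => hc hc' ef.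
have es : s = s'.
  apply/ffunP => l; apply: negb_inj.
  by rewrite -(flip_sum s l hc) -(flip_sum s' l hc') ef.
congr pair => //; apply/ffunP => x; move/ffunP/(_ x): ef; rewrite !ffunE es.
exact: addIb.
Qed.

End Counting.

(** * From triples to halting runs *)

Lemma run_halted (R : pzRingType) P coins t (s : state R) :
  halted s -> run P coins t s = s.
Proof. by move=> hs; elim: t => //= t ->; rewrite /step hs. Qed.

Lemma triple_halts (R : pzRingType) coins (c : cmd) N (V : nat -> R) cp t T Q :
  triple coins c N V cp t Q -> (t < T)%N ->
  exists N' V' cp', Q N' V' cp' /\
    run (compile 0 c) coins T (State 0 N V cp false) =
      State (csize c) N' V' cp' true.
Proof.
move=> h tT; have [//|t' [N' [V' [cp' [ht' hr hQ]]]]] := h (compile 0 c) 0%N.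
exists N', V', cp'; split=> //.
have -> : T = (t' + (1 + (T - t'.+1)))%N by lia.
(* The compiled code contains no [Halt]; past its end [nth] returns the default [Halt], which takes
   the extra step. *)
rewrite runD hr runD run_halted /run /= /step /= nth_default //.
  by rewrite size_compile.
by rewrite size_compile.
Qed.

(** * The actual input and the union bound *)

Section Assembly.
Variables (R : pzRingType) (n k : nat) (A B C' : 'M[R]_n).

Let V0 := vmem (init_state' k A B C').

Lemma mx_at_ord (M : 'M[R]_n) (i j : 'I_n) : mx_at M (i * n + j) = M i j.
Proof.
have n0 : (0 < n)%N by apply: leq_ltn_trans (ltn_ord i).
rewrite /mx_at divnMDl // divn_small // addn0 modnMDl modn_small //.
by rewrite !valK.
Qed.

Lemma init_A (i j : 'I_n) : V0 (aA n i j) = A i j.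
Proof. by rewrite /V0 /= aA_lt // mx_at_ord. Qed.

Lemma init_B (i j : 'I_n) : V0 (aB n i j) = B i j.
Proof.
rewrite /V0 /= ltnNge leq_addl /= mul2n -addnn aB_lt //.
by rewrite addnK mx_at_ord.
Qed.

Lemma init_C (i j : 'I_n) : V0 (aC n i j) = C' i j.
Proof.
have h1 := aC_ge n i j; have h2 := aC_lt (ltn_ord i) (ltn_ord j).
rewrite /aS in h2; rewrite /V0 /=.
case: ltnP => [|_]; first by lia.
case: ltnP => [|_]; first by lia.
case: ltnP => [_|]; last by lia.
by rewrite mul2n -addnn addnK mx_at_ord.
Qed.

Lemma init_zero x : (aS n 0 <= x)%N -> V0 x = 0.
Proof. by rewrite /aS /V0 /= => h; rewrite !ifN // -leqNgt; lia. Qed.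

Lemma init_entry (i j : 'I_n) : entry n V0 i j = (A *m B) i j.
Proof.
rewrite mxE /entry big_mkord; apply: eq_bigr => t _.
by rewrite init_A init_B.
Qed.

Lemma init_err (i j : 'I_n) : err n V0 i j = (A *m B) i j - C' i j.
Proof. by rewrite /err -/(entry n V0 i j) init_entry init_C. Qed.

Lemma sum_nerr : (\sum_(0 <= i < n) nerr n V0 i 0 = ndiff A B C')%N.
Proof.
rewrite big_mkord /ndiff -sum1dep_card [RHS]big_mkcond /=.
rewrite -(pair_bigA _ (fun i j =>
  if C' i j != (A *m B) i j then 1 else 0))%N /=.
apply: eq_bigr => i _; rewrite /nerr -sum1_count big_mkcond big_mkord.
by apply: eq_bigr => j _; rewrite init_err subr_eq0 eq_sym; case: eqP.
Qed.

Variables (D c : nat).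
Hypothesis n0 : (0 < n)%N.
Local Notation L := (D * lg n)%N.
Local Notation T := (time_bound c n k).
Hypothesis hT : (total_cost n L V0 < T)%N.
Hypothesis hLT : (L * n <= T)%N.

Lemma succeeds_good (w : {ffun 'I_T -> bool}) :
  (forall i p b, (i < n)%N -> (b <= n)%N -> has_err n V0 i p b ->
    has (fun l => esum (coin_fun w) n V0 i l p b != 0) (iota 0 L)) ->
  succeeds (compile 0 (correct_product D)) k A B C' w.
Proof.
move=> good.
have hs := correct_product_spec good k n0 erefl init_zero.
have [N' [V' [cp' [hV hr]]]] := triple_halts hs hT.
rewrite /succeeds -/(coin_fun w) [run _ _ _ _]hr /=.
apply/forallP => i; apply/forallP => j; rewrite -init_entry -hV //.
by apply/eqP; congr V'; rewrite /aC; lia.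
Qed.

(** A nonempty interval is encoded by its first and last columns, hence the successor; this gives
    exactly [n ^ 3] events. *)
Definition missed (x : 'I_n * 'I_n * 'I_n) : {set {ffun 'I_T -> bool}} :=
  if has_err n V0 x.1.1 x.1.2 x.2.+1 then
    undetected T n L x.1.2 x.2.+1 (err n V0 x.1.1) else set0.

Lemma card_missed x : (#|missed x| * 2 ^ L <= 2 ^ T)%N.
Proof.
rewrite /missed; case: ifP => [/hasP[j]|]; last by rewrite cards0.
rewrite mem_index_iota => hj hE.
by apply: card_undetected hE => //; apply: ltn_ord.
Qed.

Lemma card_failures :
  (#|[set w : {ffun 'I_T -> bool} |
      ~~ succeeds (compile 0 (correct_product D)) k A B C' w]| * 2 ^ L
    <= n ^ 3 * 2 ^ T)%N.
Proof.
set F := [set w | _].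
(* Coins outside all these events detect every interval with an error, so the run succeeds. *)
have sub : F \subset \bigcup_x missed x.
  apply/subsetP => w; rewrite inE; apply: contraR => nw.
  apply: succeeds_good => i p b hi hb hE.
  have [j] := hasP hE; rewrite mem_index_iota => /andP[pj jb] _.
  have pn : (p < n)%N by lia.
  have bn : (b.-1 < n)%N by lia.
  have eb : b = b.-1.+1 by lia.
  apply: contraR nw => nh; apply/bigcupP.
  exists (Ordinal hi, Ordinal pn, Ordinal bn) => //.
  rewrite /missed /= -eb hE inE; apply/allP => l hl.
  by move/hasPn: nh => /(_ l hl); rewrite negbK.
apply: leq_trans (_ : (\sum_x #|missed x|) * 2 ^ L <= _)%N.
  rewrite leq_mul2r; apply/orP; right.
  apply: leq_trans (subset_leq_card sub) _.
  apply: (big_ind2 (fun (S : {set _}) m => #|S| <= m)%N) => //.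
    by rewrite cards0.
  move=> S1 m1 S2 m2 h1 h2; apply: leq_trans (leq_add h1 h2).
  exact: leq_card_setU.
rewrite big_distrl /=; apply: leq_trans (leq_sum _ (fun x _ => card_missed x)) _.
by rewrite sum_nat_const !card_prod card_ord expnS expnS expn1 mulnA.
Qed.

End Assembly.

(* Passage to real probabilities *)
Local Delimit Scope R_scope with Re.

Lemma INR_expn (m n : nat) : INR (m ^ n) = pow (INR m) n.
Proof. by elim: n => //= n IH; rewrite expnS mult_INR IH. Qed.

Lemma whp_bound_le1 n alpha : (n <= 1)%N -> (whp_bound n alpha <= 0)%Re.
Proof.
case: n => [|[|n]] // _; rewrite /whp_bound /Rpower.
  (* [ln] is 0 by convention outside the positive reals, so [Rpower] gives 1 at [n = 0] as well. *)
  have -> : ln (INR 0) = 0%Re.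
    by rewrite /ln; case: Rlt_dec => // h; case: (Rlt_irrefl _ h).
  by rewrite Rmult_0_r exp_0; lra.
by rewrite ln_1 Rmult_0_r exp_0; lra.
Qed.

Lemma whp_bound_le_ratio n a F T alpha : (0 < n)%N -> (alpha <= INR a)%Re ->
  (F * n ^ a <= 2 ^ T)%N ->
  (whp_bound n alpha <= 1 - INR F / pow (INR 2) T)%Re.
Proof.
move=> n0 ha /leP /le_INR; rewrite mult_INR !INR_expn => h.
have n1 : (1 <= INR n)%Re by apply: (le_INR 1); apply/leP.
have hp : (0 < pow (INR 2) T)%Re by apply: pow_lt => /=; lra.
have hna : (0 < pow (INR n) a)%Re by apply: pow_lt; lra.
have e1 : Rpower (INR n) (- INR a) = (/ pow (INR n) a)%Re.
  by rewrite Rpower_Ropp Rpower_pow //; lra.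
have e2 : (Rpower (INR n) (- INR a) <= Rpower (INR n) (- alpha))%Re.
  by apply: Rle_Rpower; lra.
have e3 : (INR F / pow (INR 2) T <= / pow (INR n) a)%Re.
  apply: (Rmult_le_reg_r (pow (INR 2) T * pow (INR n) a)).
    exact: Rmult_lt_0_compat.
  have -> : (INR F / pow (INR 2) T * (pow (INR 2) T * pow (INR n) a) =
    INR F * pow (INR n) a)%Re by field; lra.
  have -> : (/ pow (INR n) a * (pow (INR 2) T * pow (INR n) a) =
    pow (INR 2) T)%Re by field; lra.
  exact: h.
by rewrite /whp_bound; move: e2 e3; rewrite e1; lra.
Qed.

Theorem theorem6 :
  forall alpha : Reals.Rdefinitions.R,
  Reals.Rdefinitions.Rle Reals.Rdefinitions.R1 alpha ->
  exists (P : program) (c : nat),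
  forall (R : pzRingType) (n k : nat) (A B C' : 'M[R]_n),
  (ndiff A B C' <= k)%N ->
  Reals.Rdefinitions.Rle (whp_bound n alpha)
    (success_prob P k (time_bound c n k) A B C').
Proof.
move=> alpha _.
have [a ha] : exists a, (alpha <= INR a)%Re.
  by have [a ha] := INR_unbounded alpha; exists a; lra.
(* With [L = D * lg n] one has [2 ^ L >= n ^ (a + 3)]: three powers of [n] pay for the union bound,
   the other [a] for the failure probability. *)
set D := (a + 3)%N; exists (compile 0 (correct_product D)), (500 * D)%N.
move=> R n k A B C' hk; set T := time_bound _ _ _.
have pT : (0 < pow (INR 2) T)%Re by apply: pow_lt => /=; lra.
(* For [n <= 1] the required probability is at most 0. At [n = 0] the time bound is 0, so no run
   could halt. *)
case: (leqP n 1) => [n1|n1].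
  apply: Rle_trans (whp_bound_le1 alpha n1) _.
  apply: Rmult_le_pos; first exact: pos_INR.
  exact/Rlt_le/Rinv_0_lt_compat.
have n0 : (0 < n)%N by lia.
have hT : (total_cost n (D * lg n) (vmem (init_state' k A B C')) < T)%N.
  by apply: total_cost_bound; rewrite ?sum_nerr // /D; lia.
(* The [T] random bits must cover the [L * n] coins of the random vectors. *)
have hLT : (D * lg n * n <= T)%N.
  rewrite /T /time_bound; set m := (n + _)%N.
  have -> : (500 * D * (m * n * lg n) = D * lg n * n * (500 * m))%N by lia.
  by rewrite leq_pmulr // muln_gt0 addn_gt0 n0.
have := card_failures n0 hT hLT.
rewrite /success_prob; set S := [set w | succeeds _ _ _ _ _ w].
set F := [set w | _] => hF.
have eS : (#|S| + #|F| = 2 ^ T)%N.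
  have -> : F = ~: S by apply/setP => w; rewrite !inE.
  by rewrite cardsC card_ffun card_bool card_ord.
have hFn : (#|F| * n ^ a <= 2 ^ T)%N.
  have hn : (n ^ a * n ^ 3 <= 2 ^ (D * lg n))%N.
    by rewrite -expnD mulnC expnM leq_exp2r ?addn3 // ltnW // trunc_log_ltn.
  have := leq_trans (leq_mul (leqnn #|F|) hn) hF.
  by rewrite mulnA [leqLHS]mulnC leq_pmul2l // expn_gt0 n0.
apply: Rle_trans (whp_bound_le_ratio n0 ha hFn) _.
rewrite -INR_expn -eS plus_INR; apply: Req_le.
have := pT; rewrite -INR_expn -eS plus_INR => h.
by field; lra.
Qed.
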